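(* Let $K$ be a $\Delta$-$\sigma$-field with basic set $\Delta\cup\{\sigma\}$, $\Delta=\{\delta_1,\dots,\delta_m\}$, let $R=K\{y_1,\dots,y_n\}$ be the ring of $\Delta$-$\sigma$-polynomials in $\Delta$-$\sigma$-indeterminates $y_1,\dots,y_n$ over $K$, and let $P$ be a prime $\Delta$-$\sigma$-ideal of $R$ (not necessarily reflexive). For $r,s\in\mathbb{N}$ let $R_{rs}=K[\{\tau y_i \mid \tau\in T(r,s),\ 1\le i\le n\}]$, let $P_{rs}=P\cap R_{rs}$, and let $L_{rs}$ be the quotient field of the integral domain $R_{rs}/P_{rs}$. Then there exists a bivariate numerical polynomial $\psi_P(t_1,t_2)$ such that (i) $\psi_P(r,s)=\operatorname{tr.deg}_K L_{rs}$ for all sufficiently large pairs $(r,s)\in\mathbb{N}^2$ (that is, there exist $r_0,s_0\in\mathbb{N}$ such that the equality holds for all $r\ge r_0$, $s\ge s_0$); (ii) the polynomial $\psi_P(t_1,t_2)$ is linear with respect to $t_2$ (that is, $\deg_{t_2}\psi_P\le 1$) and $\deg_{t_1}\psi_P\le m$, so that it can be written as $$\psi_P(t_1,t_2)=\psi_P^{(1)}(t_1)\,t_2+\psi_P^{(2)}(t_1)$$ where $\psi_P^{(1)}(t_1)$ and $\psi_P^{(2)}(t_1)$ are numerical polynomials in one variable.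
   Context: $\mathbb{N}$ denotes the non-negative integers. All fields have characteristic zero. A $\Delta$-$\sigma$-ring (difference-differential ring with one translation) is a commutative ring with unity together with a finite set $\Delta=\{\delta_1,\dots,\delta_m\}$ of derivations (the case $\Delta=\emptyset$, $m=0$, is allowed) and an injective ring endomorphism $\sigma$, such that any two of the maps in $\Delta\cup\{\sigma\}$ commute; a $\Delta$-$\sigma$-field is such a ring that is a field. $T$ is the free commutative semigroup of all power products $\tau=\delta_1^{k_1}\cdots\delta_m^{k_m}\sigma^l$ ($k_i,l\in\mathbb{N}$); $\operatorname{ord}_\Delta\tau=\sum_{i=1}^m k_i$, $\operatorname{ord}_\sigma\tau=l$, and $T(r,s)=\{\tau\in T\mid \operatorname{ord}_\Delta\tau\le r,\ \operatorname{ord}_\sigma\tau\le s\}$. The ring of $\Delta$-$\sigma$-polynomials $K\{y_1,\dots,y_n\}$ is the polynomial ring over $K$ in the indeterminates $\tau y_j$ ($\tau\in T$, $1\le j\le n$), made into a $\Delta$-$\sigma$-ring by $\alpha(\tau y_j)=(\alpha\tau)y_j$ for $\alpha\in\Delta\cup\{\sigma\}$ and by letting $\Delta\cup\{\sigma\}$ act on coefficients as on $K$. A $\Delta$-$\sigma$-ideal is an ideal $I$ closed under all maps of $\Delta\cup\{\sigma\}$; it is prime if it is a prime ideal; it is reflexive if $\sigma^k(a)\in I$ ($k\in\mathbb{N}$) implies $a\in I$. A numerical polynomial in $p$ variables is a polynomial with rational coefficients that takes integer values at all sufficiently large $p$-tuples of integers. *)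

(* Defs.v *)
From HB Require Import structures.
From mathcomp Require Import all_boot all_order all_algebra finmap.
From mathcomp Require monalg.
From mathcomp Require Import mpoly ring.
From mathcomp Require boolp.

Set Implicit Arguments.
Unset Strict Implicit.
Unset Printing Implicit Defensive.

Import GRing.Theory.
Local Open Scope ring_scope.

Record is_dsring (m : nat) (A : comNzRingType)
    (delta : 'I_m -> A -> A) (sigma : A -> A) : Prop := IsDSRing {
  delta_additive : forall i, zmod_morphism (delta i);
  delta_leibniz : forall i a b, delta i (a * b) = delta i a * b + a * delta i b;
  sigma_additive : zmod_morphism sigma;
  sigma_multiplicative : monoid_morphism sigma;
  sigma_injective : injective sigma;
  delta_comm : forall i j a, delta i (delta j a) = delta j (delta i a);
  delta_sigma_comm : forall i a, delta i (sigma a) = sigma (delta i a)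
}.

Definition is_dsideal (m : nat) (A : comNzRingType)
    (delta : 'I_m -> A -> A) (sigma : A -> A) (I : {pred A}) : Prop :=
  (forall i a, a \in I -> delta i a \in I) /\
  (forall a, a \in I -> sigma a \in I).

Lemma additiveD (A B : zmodType) (g : A -> B) : zmod_morphism g ->
  (g 0 = 0) * {morph g : a b / a + b}.
Proof.
move=> gB; have g0 : g 0 = 0 by rewrite -[X in g X](subrr 0) gB subrr.
by split=> // a b; rewrite -[b in LHS]opprK -[- b]sub0r !gB g0 sub0r opprK.
Qed.

Section PolyRing.
(* The names and notations of monalg clash with those of mpoly, so monalg is
   imported in this section only. *)
Import monalg.

(* The polynomial ring K[I] in a possibly infinite set I of indeterminates. *)
Definition polyring (K : fieldType) (I : choiceType) := {malg K[{cmonom I}]}.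

HB.instance Definition _ K I := GRing.ComAlgebra.on (polyring K I).

Context (K : fieldType) (I : choiceType).
Local Notation R := (polyring K I).
Local Notation M := {cmonom I}.
Implicit Types (p q : R) (u v : M) (x : I).

Definition prC (c : K) : R := c%:MP.
Definition prM (u : M) : R := << u >>.
Definition prX (x : I) : R := prM (ucm x).

(* The subring K[V], for V a subset of I. *)
Definition poly_in (V : {pred I}) : {pred R} :=
  fun p => all (fun u : M => all (fun x => x \in V) (finsupp u)) (msupp p).

(* pr_deriv d f is the derivation of K[I] that extends the derivation d of K and
   maps each indeterminate x to f x: on a monomial u it is
   \sum_x u(x) (u / x) (f x). See pr_deriv_additive, pr_deriv_leibniz, pr_derivC
   and pr_derivX. *)
Definition mon_deriv (f : I -> I) u : R :=
  \sum_(x <- finsupp u) prM (divcm u (ucm x)) * prX (f x) *+ u x.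

Definition pr_deriv (d : K -> K) (f : I -> I) p : R :=
  \sum_(u <- msupp p)
    (prC (d (mcoeff u p)) * prM u + prC (mcoeff u p) * mon_deriv f u).

(* pr_endo s f is the endomorphism of K[I] that extends the endomorphism s of K
   and maps each indeterminate x to f x. See pr_endo_additive,
   pr_endo_multiplicative, pr_endoC and pr_endoX. *)
Definition mon_subst (f : I -> I) u : R :=
  \prod_(x <- finsupp u) prX (f x) ^+ u x.

Definition pr_endo (s : K -> K) (f : I -> I) p : R :=
  \sum_(u <- msupp p) prC (s (mcoeff u p)) * mon_subst f u.

Lemma prU (c : K) u : << c *g u >> = prC c * prM u :> R.
Proof.
rewrite /prC /prM mul_malgC; apply/malgP => k; rewrite mcoeffZ [LHS]mcoeffU.
by rewrite [in RHS]mcoeffU mulrnAr mulr1.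
Qed.

Lemma prmonM u v : prM (mul u v) = prM u * prM v.
Proof. by rewrite /prM malgM_def fgmulUU mulr1. Qed.

Definition mon_pow x k : M := iter k (mul (ucm x)) one.

Lemma prX_exp x k : prX x ^+ k = prM (mon_pow x k).
Proof.
by elim: k => [//|k IH]; rewrite exprS IH /mon_pow iterS [RHS]prmonM.
Qed.

Lemma mon_powE x k y : mon_pow x k y = (k * (x == y))%N.
Proof. by elim: k => [|k IH]; rewrite /= ?cm1 // cmM IH cmU mulSn. Qed.

Lemma mon_bigE (r : seq I) (F : I -> M) y :
  (\big[mul/one]_(x <- r) F x) y = (\sum_(x <- r) F x y)%N.
Proof. by elim: r => [|x r IH]; rewrite ?big_nil ?big_cons ?cm1 // cmM IH. Qed.

Lemma prM_big (r : seq I) (F : I -> M) :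
  prM (\big[mul/one]_(x <- r) F x) = \prod_(x <- r) prM (F x).
Proof. exact: (big_morph prM prmonM (erefl : prM one = 1 :> R)). Qed.

Lemma prmon_prod u (d : {fset I}) : fsubset (finsupp u) d ->
  prM u = \prod_(x <- d) prX x ^+ u x.
Proof.
move=> sud; under eq_bigr do rewrite prX_exp.
rewrite -prM_big; congr prM; apply/eqP/cmP => y.
rewrite mon_bigE; under eq_bigr do rewrite mon_powE.
have [yd|yd] := boolP (y \in d).
  rewrite (big_fsetD1 y) //= eqxx muln1 big_seq big1 ?addn0 // => x.
  by rewrite in_fsetD1 => /andP[/negPf-> _]; rewrite muln0.
rewrite big_seq big1 => [|x xd].
  by apply/eqP; rewrite cmE_eq0; apply: contra yd => /(fsubsetP sud).
by case: eqP xd yd => [->->|]; rewrite ?muln0.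
Qed.

Lemma polyring_ind (Q : R -> Prop) :
    (forall c, Q (prC c)) -> (forall x, Q (prX x)) ->
    (forall p q, Q p -> Q q -> Q (p + q)) ->
    (forall p q, Q p -> Q q -> Q (p * q)) ->
  forall p, Q p.
Proof.
move=> QC QX QD QM p.
have Q0 : Q 0 by have := QC 0; rewrite /prC malgC0E.
have Q1 : Q 1 by have := QC 1; rewrite /prC mpolyC1E.
have QZ (c : K) u : Q << c *g u >>.
  rewrite prU; apply: (QM); first exact: QC.
  rewrite (prmon_prod (fsubset_refl _)).
  apply: (big_ind Q) => [||x _]; [exact: Q1|exact: QM|].
  elim: (u x) => [|k IH]; first exact: Q1.
  rewrite exprS; exact (QM _ _ (QX x) IH).
rewrite (monalgE p).
by apply: (big_ind Q) => [||u _]; [exact: Q0|exact: QD|exact: QZ].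
Qed.

Lemma mon_derivEw f u (d : {fset I}) : fsubset (finsupp u) d ->
  mon_deriv f u = \sum_(x <- d) prM (divcm u (ucm x)) * prX (f x) *+ u x.
Proof.
move=> sud; apply: big_fset_incl => // x _.
by rewrite -cmE_eq0 => /eqP->; rewrite mulr0n.
Qed.

Lemma mon_substEw f u (d : {fset I}) : fsubset (finsupp u) d ->
  mon_subst f u = \prod_(x <- d) prX (f x) ^+ u x.
Proof.
move=> sud; apply: big_fset_incl => // x _.
by rewrite -cmE_eq0 => /eqP->; rewrite expr0.
Qed.

Lemma mon_derivM f u v :
  mon_deriv f (mul u v) = mon_deriv f u * prM v + prM u * mon_deriv f v.
Proof.
pose d := fsetU (finsupp u) (finsupp v).
rewrite (@mon_derivEw f (mul u v) d) ?mdomD ?fsubset_refl //.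
rewrite (@mon_derivEw f u d) ?fsubsetUl // (@mon_derivEw f v d) ?fsubsetUr //.
rewrite [X in _ = X + _]mulr_suml [X in _ = _ + X]mulr_sumr -[RHS]big_split /=.
apply: eq_bigr => x _.
have shift (w w' : M) : w x != 0%N ->
    divcm (mul w w') (ucm x) = mul (divcm w (ucm x)) w'.
  move=> wx0; apply/eqP/cmP => y; rewrite cmM !divcmE cmM cmU.
  by case: eqP => [<-|]; rewrite ?subn0 // addnBAC // lt0n.
have scaled (w w' : M) : prM (divcm (mul w w') (ucm x)) * prX (f x) *+ w x
    = prM (divcm w (ucm x)) * prX (f x) *+ w x * prM w' :> R.
  have [->|wx0] := eqVneq (w x) 0%N; first by rewrite [LHS]mulr0n [X in X * _]mulr0n [RHS]mul0r.
  have alg (A : comNzRingType) (a b c : A) k : a * b * c *+ k = a * c *+ k * b.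
    by rewrite mulrnAl mulrAC.
  by rewrite (shift _ _ wx0) prmonM; exact: (alg R).
rewrite cmM [LHS]mulrnDr; apply: (f_equal2 (fun a b => a + b)) (scaled u v) _.
by rewrite (mulcmC u v : mul u v = mul v u); exact: etrans (scaled v u) (mulrC _ _).
Qed.

Lemma mon_substM f u v : mon_subst f (mul u v) = mon_subst f u * mon_subst f v.
Proof.
pose d := fsetU (finsupp u) (finsupp v).
rewrite (@mon_substEw f (mul u v) d) ?mdomD ?fsubset_refl //.
rewrite (@mon_substEw f u d) ?fsubsetUl // (@mon_substEw f v d) ?fsubsetUr //.
by rewrite -big_split /=; apply: eq_bigr => x _; rewrite cmM exprD.
Qed.

Lemma mon_subst1 f : mon_subst f one = 1.
Proof. by rewrite /mon_subst mdom1 big_seq_fset0. Qed.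

Lemma mon_deriv1 f : mon_deriv f one = 0.
Proof. by rewrite /mon_deriv mdom1 big_seq_fset0. Qed.

Lemma prC_B : {morph prC : a b / a - b}. Proof. exact: monalgUB. Qed.
Lemma prC_M : {morph prC : a b / a * b}. Proof. exact: mpolyCM. Qed.
Lemma prC_0 : prC 0 = 0. Proof. exact: malgC0E. Qed.
Lemma prC_1 : prC 1 = 1. Proof. exact: mpolyC1E. Qed.

Lemma polyring_addind (Q : R -> Prop) :
    Q 0 -> (forall p q, Q p -> Q q -> Q (p + q)) ->
    (forall c u, Q (prC c * prM u)) ->
  forall p, Q p.
Proof.
move=> Q0 QD QCM p; rewrite (monalgE p); apply: (big_ind Q) => [||u _].
- exact: Q0.
- exact: QD.
- by rewrite prU; exact: QCM.
Qed.

Section Extend.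
Variables (d s : K -> K) (f : I -> I).
Hypotheses (dB : zmod_morphism d) (sB : zmod_morphism s).
Hypotheses (sM : monoid_morphism s).
Hypothesis dM : forall a b, d (a * b) = d a * b + a * d b.

Let d0 : d 0 = 0. Proof. by rewrite (additiveD dB). Qed.
Let s0 : s 0 = 0. Proof. by rewrite (additiveD sB). Qed.

Lemma pr_derivEw p (D : {fset M}) : fsubset (msupp p) D ->
  pr_deriv d f p = \sum_(u <- D)
    (prC (d (mcoeff u p)) * prM u + prC (mcoeff u p) * mon_deriv f u).
Proof.
move=> spD; apply: big_fset_incl => // u _ /mcoeff_outdom ->.
by rewrite d0 prC_0 (@mul0r R) (@mul0r R) (@addr0 R).
Qed.

Lemma pr_endoEw p (D : {fset M}) : fsubset (msupp p) D ->
  pr_endo s f p = \sum_(u <- D) prC (s (mcoeff u p)) * mon_subst f u.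
Proof.
move=> spD; apply: big_fset_incl => // u _ /mcoeff_outdom ->.
by rewrite s0 prC_0 (@mul0r R).
Qed.

Lemma pr_deriv_additive : zmod_morphism (pr_deriv d f).
Proof.
move=> p q; pose D := fsetU (msupp p) (msupp q).
rewrite (@pr_derivEw p D) ?fsubsetUl // (@pr_derivEw q D) ?fsubsetUr //.
rewrite (@pr_derivEw (p - q) D); last exact: msuppB_le.
have alg (A : comNzRingType) (a b c e x y : A) :
    (a - b) * x + (c - e) * y = (a * x + c * y) - (b * x + e * y).
  by rewrite !mulrBl opprD addrACA.
rewrite -[RHS](sumrB (enum_fset D) xpredT); apply: eq_bigr => u _.
by rewrite mcoeffB dB !prC_B; exact: (alg R).
Qed.

Lemma pr_endo_additive : zmod_morphism (pr_endo s f).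
Proof.
move=> p q; pose D := fsetU (msupp p) (msupp q).
rewrite (@pr_endoEw p D) ?fsubsetUl // (@pr_endoEw q D) ?fsubsetUr //.
rewrite (@pr_endoEw (p - q) D); last exact: msuppB_le.
rewrite -[RHS](sumrB (enum_fset D) xpredT); apply: eq_bigr => u _.
by rewrite mcoeffB sB prC_B; exact: (@mulrBl R).
Qed.

Lemma pr_derivCM c u :
  pr_deriv d f (prC c * prM u) = prC (d c) * prM u + prC c * mon_deriv f u.
Proof.
apply: (etrans (f_equal (pr_deriv d f) (esym (prU c u)))).
rewrite (@pr_derivEw _ [fset u]%fset) ?msuppU_le // big_seq_fset1.
by rewrite mcoeffUU.
Qed.

Lemma pr_endoCM c u :
  pr_endo s f (prC c * prM u) = prC (s c) * mon_subst f u.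
Proof.
apply: (etrans (f_equal (pr_endo s f) (esym (prU c u)))).
rewrite (@pr_endoEw _ [fset u]%fset) ?msuppU_le // big_seq_fset1.
by rewrite mcoeffUU.
Qed.

Lemma pr_deriv_leibniz p q :
  pr_deriv d f (p * q) = pr_deriv d f p * q + p * pr_deriv d f q.
Proof.
have [D0 DD] := additiveD pr_deriv_additive.
pose L (A : comNzRingType) (D : A -> A) a b := D (a * b) = D a * b + a * D b.
have L0l (A : comNzRingType) (D : A -> A) b : D 0 = 0 -> L A D 0 b.
  by rewrite /L => e; rewrite !mul0r e mul0r addr0.
have L0r (A : comNzRingType) (D : A -> A) a : D 0 = 0 -> L A D a 0.
  by rewrite /L => e; rewrite !mulr0 e mulr0 addr0.
have LDl (A : comNzRingType) (D : A -> A) a a' b : {morph D : x y / x + y} ->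
    L A D a b -> L A D a' b -> L A D (a + a') b.
  by rewrite /L => e h h'; rewrite mulrDl !e h h' !mulrDl addrACA.
have LDr (A : comNzRingType) (D : A -> A) a b b' : {morph D : x y / x + y} ->
    L A D a b -> L A D a b' -> L A D a (b + b').
  by rewrite /L => e h h'; rewrite mulrDr !e h h' !mulrDr addrACA.
elim/polyring_addind: p q => [q|p p' IH IH' q|c u q].
- exact: (L0l R).
- exact: (LDl R _ _ _ _ DD (IH q) (IH' q)).
elim/polyring_addind: q => [|q q' IH IH'|c' v].
- exact: (L0r R).
- exact: (LDr R _ _ _ _ DD IH IH').
have E : prC c * prM u * (prC c' * prM v) = prC (c * c') * prM (mul u v).
  by rewrite prC_M prmonM; exact: (@mulrACA R).
apply: (etrans (f_equal (pr_deriv d f) E)).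
apply: (etrans (pr_derivCM _ _)).
have prC_D a b : prC (a + b) = prC a + prC b by exact: monalgUD.
rewrite dM mon_derivM prmonM prC_D (prC_M (d c)) (prC_M c c') (prC_M c (d c')).
have alg (A : comNzRingType) (a a' b b' x y m n' : A) :
  (a' * b + a * b') * (x * y) + (a * b) * (m * y + x * n') =
  (a' * x + a * m) * (b * y) + (a * x) * (b' * y + b * n').
  by ring.
exact: (etrans (alg R _ _ _ _ _ _ _ _) (esym (f_equal2
  (fun y z => y * (prC c' * prM v) + prC c * prM u * z)
  (pr_derivCM c u) (pr_derivCM c' v)))).
Qed.

Lemma pr_endo_multiplicative : monoid_morphism (pr_endo s f).
Proof.
have [s1 sM'] := sM; have [E0 ED] := additiveD pr_endo_additive.
split.
  have -> : 1 = prC 1 * prM one :> R by rewrite prC_1 (@mul1r R).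
  by rewrite [LHS]pr_endoCM s1 prC_1 mon_subst1 (@mulr1 R).
pose L (A : comNzRingType) (D : A -> A) a b := D (a * b) = D a * D b.
have L0l (A : comNzRingType) (D : A -> A) b : D 0 = 0 -> L A D 0 b.
  by rewrite /L => e; rewrite !mul0r e mul0r.
have L0r (A : comNzRingType) (D : A -> A) a : D 0 = 0 -> L A D a 0.
  by rewrite /L => e; rewrite !mulr0 e mulr0.
have LDl (A : comNzRingType) (D : A -> A) a a' b : {morph D : x y / x + y} ->
    L A D a b -> L A D a' b -> L A D (a + a') b.
  by rewrite /L => e h h'; rewrite mulrDl !e h h' !mulrDl.
have LDr (A : comNzRingType) (D : A -> A) a b b' : {morph D : x y / x + y} ->
    L A D a b -> L A D a b' -> L A D a (b + b').
  by rewrite /L => e h h'; rewrite mulrDr !e h h' !mulrDr.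
move=> p q.
elim/polyring_addind: p q => [q|p p' IH IH' q|c u q].
- exact: (L0l R).
- exact: (LDl R _ _ _ _ ED (IH q) (IH' q)).
elim/polyring_addind: q => [|q q' IH IH'|c' v].
- exact: (L0r R).
- exact: (LDr R _ _ _ _ ED IH IH').
have E : prC c * prM u * (prC c' * prM v) = prC (c * c') * prM (mul u v).
  by rewrite prC_M prmonM; exact: (@mulrACA R).
apply: (etrans (f_equal (pr_endo s f) E)).
apply: (etrans (pr_endoCM _ _)).
rewrite sM' mon_substM prC_M.
exact: (etrans (mulrACA _ _ _ _) (esym (f_equal2 (fun y z : R => y * z)
  (pr_endoCM c u) (pr_endoCM c' v)))).
Qed.

Lemma pr_derivC c : pr_deriv d f (prC c) = prC (d c).
Proof.
have E a : prC a * prM one = prC a by exact: (@mulr1 R).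
apply: (etrans (f_equal (pr_deriv d f) (esym (E c)))).
apply: (etrans (pr_derivCM _ _)).
rewrite mon_deriv1.
exact: (etrans (f_equal2 (fun y z : R => y + z) (E _) (mulr0 _)) (addr0 _)).
Qed.

Lemma pr_endoC c : pr_endo s f (prC c) = prC (s c).
Proof.
have E a : prC a * prM one = prC a by exact: (@mulr1 R).
apply: (etrans (f_equal (pr_endo s f) (esym (E c)))).
apply: (etrans (pr_endoCM _ _)).
by rewrite mon_subst1; exact: (@mulr1 R).
Qed.

Lemma pr_derivX x : pr_deriv d f (prX x) = prX (f x).
Proof.
have d1 : d 1 = 0.
  have := dM 1 1; rewrite !mul1r mulr1 => /eqP.
  by rewrite -subr_eq0 opprD addNKr oppr_eq0 => /eqP.
have E : prX x = prC 1 * prM (ucm x) by rewrite prC_1; exact: esym (@mul1r R _).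
apply: (etrans (f_equal (pr_deriv d f) E)).
apply: (etrans (pr_derivCM _ _)).
rewrite d1 prC_0 prC_1.
apply: (etrans (f_equal2 (fun y z : R => y + z) (mul0r _) (mul1r _))).
rewrite (@add0r R) /mon_deriv mdomU big_seq_fset1 cmUU mulr1n.
have -> : divcm (ucm x) (ucm x) = one.
  by apply/eqP/cmP => y; rewrite divcmE subnn cm1.
exact: (@mul1r R).
Qed.

Lemma pr_endoX x : pr_endo s f (prX x) = prX (f x).
Proof.
have E : prX x = prC 1 * prM (ucm x) by rewrite prC_1; exact: esym (@mul1r R _).
apply: (etrans (f_equal (pr_endo s f) E)).
apply: (etrans (pr_endoCM _ _)).
rewrite sM.1 prC_1; apply: (etrans (@mul1r R _)).
by rewrite /mon_subst mdomU big_seq_fset1 cmUU expr1.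
Qed.

Lemma pr_endo_inj : injective s -> injective f -> injective (pr_endo s f).
Proof.
move=> s_inj f_inj.
pose h u : M := \big[mul/one]_(x <- finsupp u) mon_pow (f x) (u x).
have hE u x : h u (f x) = u x.
  rewrite mon_bigE; under eq_bigr do rewrite mon_powE (inj_eq f_inj).
  have [xu|xu] := boolP (x \in finsupp u).
    rewrite (big_fsetD1 x) //= eqxx muln1 big_seq big1 ?addn0 // => z.
    by rewrite in_fsetD1 => /andP[/negPf-> _]; rewrite muln0.
  rewrite big_seq big1 => [|z zu]; first by apply/esym/eqP; rewrite cmE_eq0.
  by case: eqP zu xu => [->->|]; rewrite ?muln0.
have h_inj : injective h.
  by move=> u v e; apply/eqP/cmP => x; rewrite -(hE u x) e (hE v x).
have substE u : mon_subst f u = prM (h u).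
  by rewrite prM_big; apply: eq_bigr => x _; rewrite prX_exp.
have coeffCM c u w : mcoeff w (prC c * prM u) = c *+ (u == w).
  exact: (etrans (f_equal (mcoeff w) (esym (prU c u))) (mcoeffU _ _ _)).
have endo_coeff p v : mcoeff (h v) (pr_endo s f p) = s (mcoeff v p).
  rewrite (@pr_endoEw p (fsetU (msupp p) [fset v])%fset) ?fsubsetUl //.
  apply: (etrans (raddf_sum (mcoeff (h v)) _ _ _)).
  apply: (etrans (eq_bigr (fun u => s (mcoeff u p) *+ (h u == h v)) _)) => [u _|].
    exact: (etrans (f_equal (fun z => mcoeff (h v) (_ * z)) (substE u))
      (coeffCM _ _ _)).
  rewrite (big_fsetD1 v) ?in_fsetU ?in_fset1 ?eqxx ?orbT //=.
  rewrite big_seq big1 ?addr0 // => u; rewrite in_fsetD1 => /andP[uv _].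
  by rewrite (inj_eq h_inj) (negPf uv) mulr0n.
move=> p q e; apply/malgP => u; apply: s_inj.
by rewrite -(endo_coeff p) e (endo_coeff q).
Qed.

End Extend.


Section PolyIn.
Variable V : {pred I}.

Lemma poly_inP p : reflect
  (forall u, u \in msupp p -> forall x, x \in finsupp u -> x \in V)
  (p \in poly_in V).
Proof.
by apply: (iffP allP) => h u up; [move=> x; apply/allP: x; exact: h|
  apply/allP; exact: h].
Qed.

Lemma poly_in_subring : subring_closed (poly_in V).
Proof.
split.
- apply/poly_inP => u; rewrite (msuppC 1) oner_eq0 in_fset1 => /eqP-> x.
  by rewrite mdom1 in_fset0.
- move=> p q /poly_inP hp /poly_inP hq; apply/poly_inP => u.
  by move/(fsubsetP (msuppB_le p q)); rewrite in_fsetU => /orP[/hp|/hq].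
move=> p q /poly_inP hp /poly_inP hq; apply/poly_inP => u.
case/msuppM_le => v [w] [/hp hv /hq hw ->] x.
by rewrite mdomD in_fsetU => /orP[/hv|/hw].
Qed.

HB.instance Definition _ :=
  GRing.isSubringClosed.Build R (poly_in V) poly_in_subring.

Lemma poly_inC c : prC c \in poly_in V.
Proof.
apply/poly_inP => u; rewrite /prC msuppC; case: ifP => // _.
by rewrite in_fset1 => /eqP-> x; rewrite mdom1 in_fset0.
Qed.

Lemma poly_inX x : (prX x \in poly_in V) = (x \in V).
Proof.
apply/poly_inP/idP => [|xV u].
  by move=> h; apply: (h (ucm x)); rewrite ?msuppU1 ?mdomU in_fset1.
by rewrite msuppU1 in_fset1 => /eqP-> y; rewrite mdomU in_fset1 => /eqP->.
Qed.

Lemma poly_in_ind (Q : R -> Prop) :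
    (forall c, Q (prC c)) -> (forall x, x \in V -> Q (prX x)) ->
    (forall p q, Q p -> Q q -> Q (p + q)) ->
    (forall p q, Q p -> Q q -> Q (p * q)) ->
  forall p, p \in poly_in V -> Q p.
Proof.
move=> QC QX QD QM p /poly_inP hp.
have Q0 : Q 0 by have := QC 0; rewrite prC_0.
have Q1 : Q 1 by have := QC 1; rewrite prC_1.
rewrite (monalgE p) big_seq; apply: (big_ind Q) => [||u up].
- exact: Q0.
- exact: QD.
rewrite prU; apply: (QM); first exact: QC.
rewrite (prmon_prod (fsubset_refl _)) big_seq.
apply: (big_ind Q) => [||x xu]; [exact: Q1|exact: QM|].
elim: (u x) => [|k IH]; first exact: Q1.
rewrite exprS; exact (QM _ _ (QX x (hp u up x xu)) IH).
Qed.

End PolyIn.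

End PolyRing.

Definition subpoly (K : fieldType) (I : choiceType) (V : {pred I}) :=
  {p : polyring K I | p \in poly_in V}.

HB.instance Definition _ K I V := SubChoice.on (@subpoly K I V).
HB.instance Definition _ K I V :=
  [SubChoice_isSubComNzRing of @subpoly K I V by <:].

(* MathComp's {ideal_quot J} is only a comNzRingType, while {fraction _} needs an
   idomainType; the missing inverses are chosen classically. *)
Section PrimeQuotient.
Variables (A : comNzRingType) (J : prime_idealr A).
Local Notation Q := {ideal_quot J}.
Implicit Types x y : Q.

Definition quot_unit : {pred Q} := fun x => boolp.asbool (exists y, y * x = 1).

Definition quot_inv x : Q :=
  if boolp.pselect (exists y, y * x = 1) is left h then sval (boolp.cid h) else x.

Lemma quot_mulVx : {in quot_unit, left_inverse 1 quot_inv *%R}.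
Proof.
move=> x /boolp.asboolP ux; rewrite /quot_inv.
by case: boolp.pselect => // h; case: boolp.cid.
Qed.

Lemma quot_unitPl x y : y * x = 1 -> quot_unit x.
Proof. by move=> yx; apply/boolp.asboolP; exists y. Qed.

Lemma quot_inv_out : {in [predC quot_unit], quot_inv =1 id}.
Proof.
move=> x /boolp.asboolPn ux; rewrite /quot_inv.
by case: boolp.pselect.
Qed.

HB.instance Definition _ :=
  GRing.ComNzRing_hasMulInverse.Build Q quot_mulVx quot_unitPl quot_inv_out.

HB.instance Definition _ :=
  GRing.ComUnitRing_isIntegral.Build Q (@Quotient.rquot_IdomainAxiom A J).

End PrimeQuotient.

Section ResidueField.
Variables (K : fieldType) (I : choiceType) (V : {pred I}).
Variable P : prime_idealr (polyring K I).
Local Notation S := (subpoly K V).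

Definition contraction : {pred S} := fun a => val a \in (P : {pred polyring K I}).

Lemma in_contraction a :
  (a \in contraction) = (val a \in (P : {pred polyring K I})).
Proof. by []. Qed.

Lemma contraction_zmod_closed : zmod_closed contraction.
Proof.
split=> [|a b]; rewrite !in_contraction.
  by rewrite rmorph0 rpred0.
by move=> aP bP; rewrite rmorphB rpredB.
Qed.

HB.instance Definition _ :=
  GRing.isZmodClosed.Build S contraction contraction_zmod_closed.

Lemma contraction_proper : 1 \notin contraction /\
  forall a, {in contraction, forall b, a * b \in contraction}.
Proof.
split; first by rewrite in_contraction rmorph1 idealr1.
by move=> a b bP; rewrite in_contraction rmorphM idealMr.
Qed.

HB.instance Definition _ :=
  isProperIdeal.Build S contraction contraction_proper.

Lemma contraction_prime : prime_idealr_closed contraction.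
Proof. by move=> a b; rewrite !in_contraction rmorphM prime_idealrM. Qed.

HB.instance Definition _ :=
  isPrimeIdealrClosed.Build S contraction contraction_prime.

(* The fraction field of K[V] / (P :&: K[V]). *)
Definition residue_field : fieldType := {fraction {ideal_quot contraction}}.

Definition subpolyC (c : K) : S := Sub (prC I c) (poly_inC V c).

Definition residue_const (c : K) : residue_field :=
  FracField.tofrac (\pi_({ideal_quot contraction})%qT (subpolyC c)).

Lemma residue_const_zmod_morphism : zmod_morphism residue_const.
Proof.
move=> a b; rewrite /residue_const.
have -> : subpolyC (a - b) = subpolyC a - subpolyC b.
  by apply: val_inj; exact: prC_B.
by rewrite !rmorphB.
Qed.

Lemma residue_const_monoid_morphism : monoid_morphism residue_const.
Proof.
split=> [|a b]; rewrite /residue_const.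
  have -> : subpolyC 1 = 1 by apply: val_inj; exact: prC_1.
  by rewrite !rmorph1.
have -> : subpolyC (a * b) = subpolyC a * subpolyC b.
  by apply: val_inj; exact: prC_M.
by rewrite !rmorphM.
Qed.

HB.instance Definition _ := GRing.isZmodMorphism.Build K residue_field
  residue_const residue_const_zmod_morphism.
HB.instance Definition _ := GRing.isMonoidMorphism.Build K residue_field
  residue_const residue_const_monoid_morphism.

End ResidueField.

Section Trdeg.
Variables (K L : fieldType) (iota : {rmorphism K -> L}).

Definition alg_indep (d : nat) (b : d.-tuple L) : Prop :=
  forall p : {mpoly K[d]}, mmap iota (tnth b) p = 0 -> p = 0.

Definition transcendence_basis (d : nat) (b : d.-tuple L) : Prop :=
  alg_indep b /\ forall z : L, ~ alg_indep [tuple of z :: b].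

Definition has_trdeg (d : nat) : Prop :=
  exists b : d.-tuple L, transcendence_basis b.

End Trdeg.

Definition numerical (p : nat) (f : {mpoly rat[p]}) : Prop :=
  exists N : 'I_p -> int, forall v : 'I_p -> int,
    (forall i, N i <= v i) -> f.@[fun i => (v i)%:~R] \is a Num.int.

(* Junk value: the degree of the zero polynomial is 0. *)
Definition deg_in (p : nat) (i : 'I_p) (f : {mpoly rat[p]}) : nat :=
  \max_(u <- msupp f) u i.

(* (k, l) encodes the power product delta_1^k_1 ... delta_m^k_m sigma^l. *)
Definition pprod (m : nat) := ('X_{1..m} * nat)%type.

Definition ord_delta (m : nat) (t : pprod m) : nat := mdeg t.1.
Definition ord_sigma (m : nat) (t : pprod m) : nat := t.2.
Definition mul_delta (m : nat) (i : 'I_m) (t : pprod m) : pprod m :=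
  ((U_(i) + t.1)%MM, t.2).
Definition mul_sigma (m : nat) (t : pprod m) : pprod m := (t.1, t.2.+1).

Definition Trs (m r s : nat) : {pred pprod m} :=
  fun t => (ord_delta t <= r)%N && (ord_sigma t <= s)%N.

(* (t, j) encodes the indeterminate t y_j. *)
Definition dsvar (m n : nat) := (pprod m * 'I_n)%type.

Definition var_delta (m n : nat) (i : 'I_m) (x : dsvar m n) : dsvar m n :=
  (mul_delta i x.1, x.2).
Definition var_sigma (m n : nat) (x : dsvar m n) : dsvar m n :=
  (mul_sigma x.1, x.2).

(* The carrier K{y_1, ..., y_n}. *)
Definition dspoly (K : fieldType) (m n : nat) : comNzRingType :=
  polyring K (dsvar m n).

Section DSPoly.
Context (K : fieldType) (m n : nat).
Local Notation R := (dspoly K m n).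

Definition dsY (t : pprod m) (j : 'I_n) : R := prX K (t, j).

Definition dspoly_delta (delta : 'I_m -> K -> K) (i : 'I_m) : R -> R :=
  pr_deriv (delta i) (@var_delta m n i).

Definition dspoly_sigma (sigma : K -> K) : R -> R :=
  pr_endo sigma (@var_sigma m n).

Lemma dspoly_dsring (delta : 'I_m -> K -> K) (sigma : K -> K) :
  is_dsring delta sigma -> is_dsring (dspoly_delta delta) (dspoly_sigma sigma).
Proof.
case=> dB dM sB sM s_inj dC dsC.
have DB i := pr_deriv_additive (@var_delta m n i) (dB i).
have DL i := pr_deriv_leibniz (@var_delta m n i) (dB i) (dM i).
have SB := pr_endo_additive (@var_sigma m n) sB.
have SM := pr_endo_multiplicative (@var_sigma m n) sB sM.
have DX i := pr_derivX (@var_delta m n i) (dB i) (dM i).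
have SX := pr_endoX (@var_sigma m n) sB sM.
have DC i := pr_derivC (@var_delta m n i) (dB i).
have SC := pr_endoC (@var_sigma m n) sB.
split; [exact: DB|exact: DL|exact: SB|exact: SM|..].
- by apply: pr_endo_inj => // -[t j] [t' j'] [] e1 e2 e3; congr (_, _);
    first (by case: t t' e1 e2 => ? ? [] ? ? /= -> [->]).
- move=> i j a; rewrite /dspoly_delta; move: a.
  have closeD (A : comNzRingType) (D E : A -> A) a b :
      {morph D : x y / x + y} -> {morph E : x y / x + y} ->
      D (E a) = E (D a) -> D (E b) = E (D b) -> D (E (a + b)) = E (D (a + b)).
    by move=> hD hE ea eb; rewrite !(hE, hD) ea eb.
  have closeM (A : comNzRingType) (D E : A -> A) a b :
      {morph D : x y / x + y} -> {morph E : x y / x + y} ->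
      (forall x y, D (x * y) = D x * y + x * D y) ->
      (forall x y, E (x * y) = E x * y + x * E y) ->
      D (E a) = E (D a) -> D (E b) = E (D b) -> D (E (a * b)) = E (D (a * b)).
    by move=> hD hE mD mE ea eb; rewrite mE mD hD hE !mD !mE ea eb addrACA.
  apply: polyring_ind => [c|x|p q hp hq|p q hp hq].
  + exact: (etrans (etrans (f_equal _ (DC j c)) (DC i _))
      (etrans (f_equal (@prC K _) (dC i j c))
        (esym (etrans (f_equal _ (DC i c)) (DC j _))))).
  + have e : var_delta i (var_delta j x) = var_delta j (var_delta i x).
      by rewrite /var_delta /mul_delta /= !addmA (addmC U_(i)%MM).
    exact: (etrans (etrans (f_equal _ (DX j x)) (DX i _))
      (etrans (f_equal (@prX K _) e)
        (esym (etrans (f_equal _ (DX i x)) (DX j _))))).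
  + exact: (closeD R _ _ _ _ (additiveD (DB i)).2 (additiveD (DB j)).2 hp hq).
  + exact: (closeM R _ _ _ _ (additiveD (DB i)).2 (additiveD (DB j)).2
      (DL i) (DL j) hp hq).
move=> i a; rewrite /dspoly_delta /dspoly_sigma; move: a.
have closeD (A : comNzRingType) (D E : A -> A) a b :
    {morph D : x y / x + y} -> {morph E : x y / x + y} ->
    D (E a) = E (D a) -> D (E b) = E (D b) -> D (E (a + b)) = E (D (a + b)).
  by move=> hD hE ea eb; rewrite !(hE, hD) ea eb.
have closeM (A : comNzRingType) (D E : A -> A) a b :
    {morph E : x y / x + y} ->
    (forall x y, D (x * y) = D x * y + x * D y) ->
    {morph E : x y / x * y} ->
    D (E a) = E (D a) -> D (E b) = E (D b) -> D (E (a * b)) = E (D (a * b)).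
  by move=> hE mD mE ea eb; rewrite mE !mD hE !mE ea eb.
apply: polyring_ind => [c|x|p q hp hq|p q hp hq].
+ exact: (etrans (etrans (f_equal _ (SC c)) (DC i _))
    (etrans (f_equal (@prC K _) (dsC i c))
      (esym (etrans (f_equal _ (DC i c)) (SC _))))).
+ exact: (etrans (etrans (f_equal _ (SX x)) (DX i _))
    (esym (etrans (f_equal _ (DX i x)) (SX _)))).
+ exact: (closeD R _ _ _ _ (additiveD (DB i)).2 (additiveD SB).2 hp hq).
+ exact: (closeM R _ _ _ _ (additiveD SB).2 (DL i) SM.2 hp hq).
Qed.

Lemma dspoly_extends (delta : 'I_m -> K -> K) (sigma : K -> K) :
  is_dsring delta sigma ->
  [/\ forall i c, dspoly_delta delta i (prC _ c) = prC _ (delta i c),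
      forall i t j, dspoly_delta delta i (dsY t j) = dsY (mul_delta i t) j,
      forall c, dspoly_sigma sigma (prC _ c) = prC _ (sigma c)
    & forall t j, dspoly_sigma sigma (dsY t j) = dsY (mul_sigma t) j].
Proof.
case=> dB dM sB sM _ _ _; split=> [i c|i t j|c|t j].
- exact: pr_derivC (dB i) _.
- exact: pr_derivX (dB i) (dM i) _.
- exact: pr_endoC sB _.
- exact: pr_endoX sB sM _.
Qed.

End DSPoly.

Section Lrs.
Variables (K : fieldType) (m n : nat) (P : prime_idealr (dspoly K m n)).
Variables r s : nat.

Definition vars_rs : {pred dsvar m n} := fun x => x.1 \in Trs r s.

Definition Rrs : comNzRingType := subpoly K vars_rs.

Definition Prs : prime_idealr Rrs := @contraction K _ vars_rs P.

Definition Lrs : fieldType := {fraction {ideal_quot Prs}}.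

Definition Lrs_const : {rmorphism K -> Lrs} := @residue_const K _ vars_rs P.

End Lrs.

(* Main.v *)
(* The idea is to count a transcendence basis of L_rs that consists of
   indeterminates.  Fix k, and order the indeterminates so that those of
   sigma-order at least k (the tail) precede the others (the heads).  An
   indeterminate in T(r,s)Y is a leader if, modulo P, it is algebraic over the
   smaller ones in T(r,s)Y; leaders can be left out of a basis.  Encode
   theta sigma^l y_j in T(r,s)Y by the vector (r - |theta|, theta) together with
   l, s and j.  In characteristic 0 a relation of minimal degree has a separant
   outside P, so derivatives of leaders are leaders; hence the leaders form an
   up-closed set of vectors, which grows with s.  The heads involve finitely many
   l, so by Dickson's lemma they contribute a count that for large r and s is
   polynomial in r, of degree at most m, and independent of s.

   The tail is compared with the reflexive closure P* of P.  Since sigma is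
   injective modulo P*, the tail leaders of P* are up-closed in k and l as well,
   so that finitely many of them generate the others.  Some power of sigma maps
   their relations into P, and these stay nontrivial because some coefficient
   lies outside P*.  Thus, for large k, the tail leaders of P* are leaders for P,
   whereas the tail non-leaders of P* are independent modulo P*, hence modulo P.
   The number of these with given l and t = s - l depends, as a function of r,
   only on min(l - k, c) and min(t, c) for some c; summing over l + t = s gives
   a count that is linear in s, with coefficients polynomial in r. *)

From HB Require Import structures.
Require Import Defs.
From mathcomp Require Import all_boot all_order all_algebra finmap.
From mathcomp Require Import mpoly ring zify.
From mathcomp Require monalg boolp.

Set Implicit Arguments.
Unset Strict Implicit.
Unset Printing Implicit Defensive.

Import Order.TTheory GRing.Theory Num.Theory.

(** * Up-closed sets of vectors *)


Definition eventually (Q : nat -> Prop) : Prop :=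
  exists a, forall b, (a <= b)%N -> Q b.

Lemma eventually_seq (T : eqType) (s : seq T) (Q : T -> nat -> Prop) :
  (forall x, x \in s -> eventually (Q x)) ->
  eventually (fun b => forall x, x \in s -> Q x b).
Proof.
elim: s => [|x s IH] ev; first by exists 0%N.
have [a aQ] := ev x (mem_head x s).
have [y ys|a' a'Q] := IH; first by apply: ev; rewrite inE ys orbT.
exists (maxn a a') => b; rewrite geq_max => /andP[ab a'b] y.
by rewrite inE => /predU1P[->|]; [exact: aQ|exact: a'Q].
Qed.

Lemma eventually_fin (T : finType) (Q : T -> nat -> Prop) :
  (forall x, eventually (Q x)) -> eventually (fun b => forall x, Q x b).
Proof.
move=> ev; have [|a aQ] := @eventually_seq _ (enum T) Q; first by move=> x _.
by exists a => b ab x; apply: aQ; rewrite ?mem_enum.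
Qed.

Lemma eventually_and (Q Q' : nat -> Prop) :
  eventually Q -> eventually Q' -> eventually (fun b => Q b /\ Q' b).
Proof.
move=> [a aQ] [a' a'Q]; exists (maxn a a') => b.
by rewrite geq_max => /andP[/aQ ? /a'Q].
Qed.

(* The vectors of N^M are represented by the sequences of length M. *)
Definition upclosed (M : nat) (U : seq nat -> Prop) : Prop :=
  forall v w, size v = M -> all2 leq v w -> U v -> U w.

Lemma all2_leq_refl v : all2 leq v v.
Proof. by elim: v => //= a v ->; rewrite leqnn. Qed.

Lemma all2_leq_minn c v : all2 leq (map (minn c) v) v.
Proof. by elim: v => //= a v ->; rewrite geq_minr. Qed.

Lemma bounded_vectors M c :
  exists s : seq (seq nat), forall w, size w = M -> all (leq^~ c) w -> w \in s.
Proof.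
elim: M => [|M [s sP]]; first by exists [:: [::]] => w /size0nil->.
exists [seq a :: w | a <- iota 0 c.+1, w <- s] => -[//|a w] [sw] /andP[ac wc].
by apply/allpairsP; exists (a, w); split=> //; [rewrite mem_iota|exact: sP].
Qed.

(* Dickson's lemma: the minimal elements of U have bounded coordinates. *)
Lemma dickson M U : upclosed M U ->
  eventually (fun c => forall v, size v = M -> U v -> U (map (minn c) v)).
Proof.
elim: M U => [|M IH] U Uup; first by exists 0%N => c _ v /size0nil->.
have slice a : upclosed M (fun v => U (a :: v)).
  by move=> v w sv vw; apply: Uup; rewrite /= ?sv ?leqnn.
have slice_le a a' v : size v = M -> (a <= a')%N -> U (a :: v) -> U (a' :: v).
  by move=> sv aa'; apply: Uup; rewrite /= ?sv // aa' all2_leq_refl.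
(* The projection of [U] that forgets the first coordinate is up-closed too. By the induction
   hypothesis it is determined by finitely many points, so a single height [A] reaches all of it. *)
have Uany : upclosed M (fun v => exists a, U (a :: v)).
  by move=> v w sv vw [a Ua]; exists a; exact: slice vw Ua.
have [c0 c0P] := IH _ Uany.
have [s sP] := bounded_vectors M c0.
have [|A AP] := @eventually_seq _ s
    (fun w a => size w = M -> (exists a, U (a :: w)) -> U (a :: w)).
  move=> w _; have [[a Ua]|nU] := boolp.EM (exists a, U (a :: w)); last by exists 0%N.
  by exists a => b ab sw _; exact: slice_le ab Ua.
have UA a v : size v = M -> U (a :: v) -> U (A :: v).
  move=> sv Ua; apply: (slice A) (all2_leq_minn c0 v) _; first by rewrite size_map.
  apply: AP => //; rewrite ?size_map //.
    apply: sP; rewrite ?size_map //; apply/allP => _ /mapP[b _ ->].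
    exact: geq_minl.
  by apply: c0P => //; exists a.
have [|c1 c1P] := @eventually_seq _ (iota 0 A.+1) (fun a c =>
    forall v, size v = M -> U (a :: v) -> U (a :: map (minn c) v)).
  by move=> a _; exact: IH (slice a).
(* By [UA], the slices above height [A] add nothing to the slice at [A], so the common bound [c1]
   for the slices [0, ..., A] suffices. *)
exists (maxn c1 A) => c; rewrite geq_max => /andP[c1c Ac] [//|a v] [sv] Ua /=.
have [aA|Aa] := leqP a A.
  rewrite (minn_idPr (leq_trans aA Ac)).
  by apply: (c1P c c1c) => //; rewrite mem_iota.
have AUc : U (A :: map (minn c) v).
  by apply: (c1P c c1c) => //; [rewrite mem_iota leq0n ltnSn|exact: (UA a)].
by apply: slice_le AUc; rewrite ?size_map // leq_min Ac ltnW.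
Qed.

Fixpoint compositions (M r : nat) : seq (seq nat) :=
  if M is M'.+1 then
    flatten [seq [seq a :: v | v <- compositions M' (r - a)] | a <- iota 0 r.+1]
  else if r is 0 then [:: [::]] else [::].

Lemma compositionsS M r : compositions M.+1 r =
  [seq a :: v | a <- iota 0 r.+1, v <- compositions M (r - a)].
Proof. by []. Qed.

Lemma mem_compositions M r v :
  (v \in compositions M r) = (size v == M) && (sumn v == r).
Proof.
elim: M r v => [|M IH] r v.
  by case: r v => [|r] [|a v]; rewrite //= ?in_nil ?inE.
rewrite compositionsS; apply/allpairsPdep/andP => [[a [w [ar + ->]]]|[sv /eqP vr]].
  move: ar; rewrite mem_iota ltnS IH => ar /andP[/eqP<- /eqP wr] /=.
  by rewrite wr subnKC.
case: v sv vr => [//|a v] sv vr; exists a, v; split=> //.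
  by rewrite mem_iota ltnS -vr /= leq_addr.
by rewrite IH -vr /= addKn eqxx andbT.
Qed.

Lemma compositions_uniq M r : uniq (compositions M r).
Proof.
elim: M r => [|M IH] r; first by case: r.
rewrite compositionsS; apply: allpairs_uniq_dep => [|a _|[a v] [b w] _ _ /= [-> ->]] //.
exact: iota_uniq.
Qed.

(** For an up-closed [U] this is the Hilbert function of the polynomial ring in [M] variables modulo
    the monomial ideal with exponent set [U]. *)
Definition hilb (M : nat) (U : seq nat -> Prop) (r : nat) : nat :=
  count (fun v => ~~ boolp.asbool (U v)) (compositions M r).

Lemma eq_hilb M U U' r : (forall v, size v = M -> sumn v = r -> U v <-> U' v) ->
  hilb M U r = hilb M U' r.
Proof.
move=> UU'; apply: eq_in_count => v; rewrite mem_compositions.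
move=> /andP[/eqP sv /eqP vr]; congr (~~ _).
by apply: boolp.asbool_equiv_eq; exact: UU'.
Qed.

Lemma hilbS M U r :
  hilb M.+1 U r = (\sum_(0 <= a < r.+1) hilb M (fun v => U (a :: v)) (r - a))%N.
Proof.
rewrite /hilb compositionsS count_flatten -map_comp sumnE big_map /index_iota subn0.
by apply: eq_bigr => a _; rewrite /= count_map.
Qed.

(** * Stabilisation of families of up-closed sets *)

Section StableFamily.
Variables (T : finType) (M : nat).
Variables (Q L : T -> nat -> nat -> nat -> seq nat -> Prop).
Implicit Types (j : T) (k l t : nat) (v w : seq nat).

Hypothesis Qk : forall j k l t v, Q j k l t v -> Q j k.+1 l t v.
Hypothesis Ql : forall j k l t v, Q j k l t v -> Q j k l.+1 t v.
Hypothesis Qtv : forall j k l t v t' v', size v = M -> t <= t' -> all2 leq v v' ->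
  Q j k l t v -> Q j k l t' v'.

Lemma family_mono j k l t v k' l' t' v' : size v = M ->
    k <= k' -> l <= l' -> t <= t' -> all2 leq v v' ->
  Q j k l t v -> Q j k' l' t' v'.
Proof.
move=> sv kk' ll' tt' vv' /(Qtv sv tt' vv') q.
rewrite -(subnK kk'); elim: (k' - k) => [|d IH]; last exact: Qk.
rewrite -(subnK ll'); elim: (l' - l) => [|d IH]; [exact: q|exact: Ql].
Qed.

(** With [k], [l] and [t] as three further coordinates, each [Q j] becomes a single up-closed subset
    of N^(M+3), to which Dickson's lemma applies. *)
Lemma family_stable : eventually (fun c => forall j k l t v, size v = M ->
  Q j k l t v -> Q j (minn c k) (minn c l) (minn c t) (map (minn c) v)).
Proof.
have [|c cP] := @eventually_fin _ (fun j c => forall w, size w = M.+3 ->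
    (if w is [:: k, l, t & v] then Q j k l t v else False) ->
    (if map (minn c) w is [:: k, l, t & v] then Q j k l t v else False)).
  move=> j; apply: (@dickson M.+3 (fun w =>
    if w is [:: k, l, t & v] then Q j k l t v else False)).
  move=> [|k [|l [|t v]]] [|k' [|l' [|t' v']]]; rewrite //= ?andbF //.
  by move=> [sv] /and4P[kk' ll' tt' vv']; exact: family_mono.
exists c => b /cP h j k l t v sv; apply: (h j [:: k, l, t & v]).
by rewrite /= sv.
Qed.

Hypothesis Ltv : forall j k l t v t' v', size v = M -> t <= t' -> all2 leq v v' ->
  L j k l t v -> L j k l t' v'.
Hypothesis Lshift : forall j k d l t v, L j (k + d) l t v -> L j k (l + d) t v.
Hypothesis QL : forall j k l t v, Q j k l t v ->
  eventually (fun q => L j (k + q) l t v).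

(** After truncation at [c] only finitely many members of [Q] remain, so one delay [K0] serves in
    [QL] for all of them, and [k = c + K0] works. Any other member is reached from its truncation by
    [Lshift] and [Ltv]. *)
Lemma family_transfer : exists k c,
  (forall j l t v, size v = M -> Q j k l t v -> L j k l t v) /\
  (forall j l t v, size v = M ->
     Q j k l t v <-> Q j k (minn c l) (minn c t) v).
Proof.
have [c /(_ c (leqnn c)) cP] := family_stable.
have [W WP] := bounded_vectors M.+2 c.
have [|K0 K0P] := @eventually_fin T (fun j q => forall w, w \in W ->
    if w is [:: l, t & v] then Q j c l t v -> L j (c + q) l t v else True).
  move=> j; apply: eventually_seq => -[|l [|t v]] _; try by exists 0.
  have [q|nQ] := boolp.EM (Q j c l t v).
    by have [a aL] := QL q; exists a => b /aL.
  by exists 0 => q _ /nQ.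
exists (c + K0), c; split=> j l t v sv; last first.
  split=> [/(cP _ _ _ _ _ sv)|]; last first.
    by apply: family_mono; rewrite ?geq_minr ?all2_leq_refl.
  by apply: family_mono; rewrite ?size_map ?all2_leq_minn ?geq_minr.
move=> /(cP _ _ _ _ _ sv); rewrite (minn_idPl (leq_addr _ _)) => q.
have h : L j (c + (K0 + (l - minn c l))) (minn c l) (minn c t) (map (minn c) v).
  apply: (K0P _ (leq_addr _ _) j [:: minn c l, minn c t & map (minn c) v]) q.
  apply: WP; first by rewrite /= size_map sv.
  rewrite /= !geq_minl /=; apply/allP => _ /mapP[b _ ->]; exact: geq_minl.
(* The additional delay [l - minn c l] was put into the threshold so that [Lshift] can now convert
   it into the missing part of [l]. *)
move: h; rewrite addnA => /Lshift; rewrite subnKC ?geq_minr //.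
by apply: Ltv; rewrite ?size_map ?geq_minr ?all2_leq_minn.
Qed.

End StableFamily.

(** An increasing chain of up-closed sets is one up-closed set with [s] as an extra coordinate, and
    the minimal elements of that set have bounded [s]. *)
Lemma chain_stable (T : finType) (M : nat) (Q : T -> nat -> seq nat -> Prop) :
    (forall j s v s' v', size v = M -> s <= s' -> all2 leq v v' ->
       Q j s v -> Q j s' v') ->
  exists c, forall j s v, size v = M -> c <= s -> Q j s v <-> Q j c v.
Proof.
move=> Qmono.
have [|c /(_ c (leqnn c)) cP] := @eventually_fin _ (fun j c => forall w, size w = M.+1 ->
    (if w is s :: v then Q j s v else False) ->
    (if map (minn c) w is s :: v then Q j s v else False)).
  move=> j; apply: (@dickson M.+1 (fun w => if w is s :: v then Q j s v else False)).
  move=> [|s v] [|s' v'] //= [sv] /andP[ss' vv']; exact: Qmono.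
exists c => j s v sv cs; split; last by apply: Qmono; rewrite ?all2_leq_refl.
move=> /(cP j (s :: v)); rewrite /= sv (minn_idPl cs) => /(_ erefl).
by apply: Qmono; rewrite ?size_map ?all2_leq_minn.
Qed.

Local Open Scope ring_scope.

(** * Eventually polynomial functions *)

(** The falling factorials [F n] are monic of degree [n], and the difference operator sends [F n.+1]
    to [n.+1] times [F n]. Subtracting a multiple of [F D] removes the top coefficient, and
    induction handles the rest. *)
Lemma poly_antidifference D (p : {poly rat}) : (size p <= D)%N ->
  exists2 q : {poly rat}, (size q <= D.+1)%N & forall x, q.[x + 1] - q.[x] = p.[x].
Proof.
pose F n : {poly rat} := \prod_(i < n) ('X - (i%:R)%:P).
have FS n : F n.+1 = F n * ('X - (n%:R)%:P) by rewrite /F big_ord_recr.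
have monF n : F n \is monic by rewrite monic_prod // => i _; exact: monicXsubC.
have sizeF n : size (F n) = n.+1.
  by rewrite /F -big_enum size_prod_XsubC size_enum_ord.
have FSl n x : (F n.+1).[x + 1] = (x + 1) * (F n).[x].
  elim: n => [|n IH]; first by rewrite FS /F big_ord0 !hornerE; ring.
  by rewrite FS hornerM IH FS hornerM !hornerXsubC -natr1; ring.
elim: D p => [|D IH] p.
  rewrite leqn0 size_poly_eq0 => /eqP->.
  by exists 0 => [|x]; rewrite ?size_poly0 ?hornerE.
move=> sp; pose c := p`_D.
have [|q sq qE] := IH (p - c *: F D).
  apply/leq_sizeP => j; rewrite leq_eqVlt => /predU1P[<-|Dj].
    have := monicP (monF D); rewrite lead_coefE sizeF => FD.
    by rewrite coefB coefZ FD mulr1 subrr.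
  by rewrite coefB coefZ !nth_default ?mulr0 ?subr0 // ?sizeF // (leq_trans sp).
exists (q + (c / D.+1%:R) *: F D.+1) => [|x].
  rewrite (leq_trans (size_polyD _ _)) // geq_max (leq_trans sq) ?leqnSn //=.
  by rewrite (leq_trans (size_scale_leq _ _)) // sizeF.
have D0 : D.+1%:R != 0 :> rat by rewrite pnatr_eq0.
have -> : p.[x] = (p - c *: F D).[x] + c * (F D).[x] by rewrite !hornerE subrK.
rewrite -qE !hornerD !hornerZ FSl FS hornerM hornerXsubC.
by move: D0; rewrite -natr1 => D0; field.
Qed.

(** The bound is on the size, so the degree is less than [D]; the value [D = 0], for functions that
    are eventually zero, starts the induction in [hilb_evpoly]. *)
Definition evpoly (D : nat) (f : nat -> rat) : Prop :=
  exists2 p : {poly rat}, (size p <= D)%N & eventually (fun r => f r = p.[r%:R]).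

Lemma eq_evpoly D f g : eventually (fun r => f r = g r) -> evpoly D f -> evpoly D g.
Proof.
move=> fg [p sp fp]; exists p => //.
have [a ab] := eventually_and fg fp; exists a => b /ab[<- <-] //.
Qed.

Lemma evpoly_leq D D' f : (D <= D')%N -> evpoly D f -> evpoly D' f.
Proof. by move=> DD' [p sp fp]; exists p => //; exact: leq_trans DD'. Qed.

Lemma evpoly0 D : evpoly D (fun=> 0).
Proof. by exists 0; [rewrite size_poly0|exists 0%N => b _; rewrite horner0]. Qed.

Lemma evpolyD D f g : evpoly D f -> evpoly D g -> evpoly D (fun r => f r + g r).
Proof.
move=> [p sp fp] [q sq gq]; exists (p + q).
  by rewrite (leq_trans (size_polyD _ _)) // geq_max sp.
have [a ab] := eventually_and fp gq; exists a => b /ab[-> ->].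
by rewrite hornerD.
Qed.

Lemma evpoly_sum D (T : Type) (s : seq T) (f : T -> nat -> rat) :
  (forall i, evpoly D (f i)) -> evpoly D (fun r => \sum_(i <- s) f i r).
Proof.
move=> ef; elim: s => [|i s IH].
  by apply: eq_evpoly (evpoly0 D); exists 0%N => b _; rewrite big_nil.
by apply: eq_evpoly (evpolyD (ef i) IH); exists 0%N => b _; rewrite big_cons.
Qed.

Lemma evpoly_shift D f a : evpoly D f -> evpoly D (fun r => f (r - a)%N).
Proof.
move=> [p sp [b fb]]; exists (p \Po ('X - (a%:R)%:P)).
  by rewrite size_comp_poly2 // size_XsubC.
exists (b + a)%N => r bar.
rewrite horner_comp !hornerE fb; last by rewrite leq_subRL; lia.
by rewrite natrB //; lia.
Qed.

Lemma evpoly_shiftr D f a : evpoly D f -> evpoly D (fun r => f (r + a)%N).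
Proof.
move=> [p sp [b fb]]; exists (p \Po ('X + (a%:R)%:P)).
  by rewrite size_comp_poly2 // size_XaddC.
exists b => r br; rewrite horner_comp !hornerE.
by rewrite fb ?natrD // (leq_trans br) ?leq_addr.
Qed.

Lemma evpoly_psum D f : evpoly D f -> evpoly D.+1 (fun r => \sum_(0 <= b < r) f b).
Proof.
move=> [p sp [a fp]]; have [q sq qE] := poly_antidifference sp.
(* The constant corrects for the first [a] terms, where [f] need not agree with [p]. *)
exists (q + (\sum_(0 <= b < a) f b - q.[a%:R])%:P).
  rewrite (leq_trans (size_polyD _ _)) // geq_max sq.
  by rewrite (leq_trans (size_polyC_leq1 _)).
exists a => r /subnK<-; elim: (r - a)%N => [|k IH].
  by rewrite add0n hornerD hornerC addrC subrK.
rewrite addSn big_nat_recr //= IH fp ?leq_addl // -qE !hornerD !hornerC -natr1.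
by ring.
Qed.

(** Slice by the first coordinate. The slices from some height [c] on are equal, so they contribute
    a partial sum of one Hilbert function in [M] variables, which raises the degree by at most one;
    the finitely many lower slices contribute shifted Hilbert functions. *)
Lemma hilb_evpoly M U : upclosed M U -> evpoly M (fun r => (hilb M U r)%:R).
Proof.
elim: M U => [|M IH] U Uup.
  (* The empty vector has sum 0, so nothing is counted from [r = 1] on. *)
  by exists 0; rewrite ?size_poly0 //; exists 1%N => -[|r] // _; rewrite horner0.
have slice a : upclosed M (fun v => U (a :: v)).
  by move=> v w sv vw; apply: Uup; rewrite /= ?sv ?leqnn.
have [c cP] := dickson Uup.
have stable a r : (c <= a)%N ->
    hilb M (fun v => U (a :: v)) r = hilb M (fun v => U (c :: v)) r.
  move=> ca; apply: eq_hilb => v sv _; split.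
    move=> /(cP c (leqnn c) (a :: v)); rewrite /= sv (minn_idPl ca) => /(_ erefl).
    by apply: slice; rewrite ?size_map ?all2_leq_minn.
  by apply: Uup; rewrite /= ?sv // ca all2_leq_refl.
apply: (@eq_evpoly _ (fun r =>
  \sum_(a <- iota 0 c) (hilb M (fun v => U (a :: v)) (r - a))%:R +
  \sum_(0 <= b < r - c + 1) (hilb M (fun v => U (c :: v)) b)%:R)).
  exists c => r cr; apply: esym.
  rewrite hilbS natr_sum (big_cat_nat (n := c)) //=; last exact: leqW.
  rewrite {1}/index_iota subn0; congr (_ + _).
  rewrite addn1 -subSn // -{1}[c]add0n big_addn.
  rewrite [LHS]big_nat_rev /=; apply: eq_big_nat => i /andP[_ ir].
  rewrite stable; last by lia.
  by congr (hilb _ _ _)%:R; lia.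
apply: evpolyD.
  apply: evpoly_sum => a; apply: evpoly_leq (leqnSn M) _.
  apply: (evpoly_shift (f := fun r => (hilb M (fun v => U (a :: v)) r)%:R)).
  exact: IH.
apply: (evpoly_shift (f := fun r => \sum_(0 <= b < r + 1) _)).
apply: (evpoly_shiftr (f := fun r => \sum_(0 <= b < r) _)).
apply: evpoly_psum.
exact: IH.
Qed.

Definition mpoly_of_poly (p : {poly rat}) : {mpoly rat[1]} :=
  \sum_(i < size p) p`_i *: 'X_ord0 ^+ i.

Lemma mpoly_of_polyE p v : (mpoly_of_poly p).@[v] = p.[v ord0].
Proof.
rewrite horner_coef rmorph_sum; apply: eq_bigr => i _ /=.
by rewrite mevalZ rmorphXn /= mevalXU.
Qed.

Lemma mpoly_of_poly_comp k (p : {poly rat}) (x : {mpoly rat[k]}) :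
  mpoly_of_poly p \mPo [tuple x] = \sum_(i < size p) p`_i *: x ^+ i.
Proof.
rewrite rmorph_sum; apply: eq_bigr => i _ /=.
by rewrite comp_mpolyZ rmorphXn /= comp_mpolyXU.
Qed.

Lemma deg_in_leP k (i : 'I_k) (f : {mpoly rat[k]}) d :
  (forall u, u \in msupp f -> (u i <= d)%N) -> (deg_in i f <= d)%N.
Proof. by move=> h; apply/bigmax_leqP_seq => u uf _; exact: h. Qed.

Lemma numerical_eventually_nat k (f : {mpoly rat[k]}) (N : nat) :
  (forall v : 'I_k -> nat, (forall i, N <= v i)%N ->
     f.@[fun i => (v i)%:R] \is a Num.int) -> numerical f.
Proof.
move=> fN; exists (fun=> N%:Z) => v vN.
pose w i := `|v i|%N.
have vE i : v i = w i :> int by rewrite /w gez0_abs // (le_trans _ (vN i)).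
rewrite (meval_eq (v2 := fun i => (w i)%:R)) => [|i]; last by rewrite vE.
by apply: fN => i; have := vN i; rewrite vE.
Qed.

Lemma bivariate_of_polys (m : nat) (p1 p2 : {poly rat}) (N : nat -> nat -> nat) r0 s0 :
    (size p1 <= m.+1)%N -> (size p2 <= m.+1)%N ->
    (forall r s, (r0 <= r)%N -> (s0 <= s)%N ->
       (N r s)%:R = p1.[r%:R] * s%:R + p2.[r%:R] :> rat) ->
  exists psi : {mpoly rat[2]},
    [/\ numerical psi,
        forall r s : nat, (r0 <= r)%N -> (s0 <= s)%N ->
          psi.@[tnth [tuple r%:R; s%:R]] = (N r s)%:R,
        (deg_in ord_max psi <= 1)%N,
        (deg_in ord0 psi <= m)%N
      & exists psi1 psi2 : {mpoly rat[1]},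
          [/\ numerical psi1, numerical psi2
            & psi = (psi1 \mPo [tuple 'X_ord0]) * 'X_ord_max
                    + (psi2 \mPo [tuple 'X_ord0])]].
Proof.
move=> s1 s2 NE; pose psi1 := mpoly_of_poly p1; pose psi2 := mpoly_of_poly p2.
pose psi : {mpoly rat[2]} := (psi1 \mPo [tuple 'X_ord0]) * 'X_ord_max
                             + (psi2 \mPo [tuple 'X_ord0]).
have psiE v : psi.@[v] = p1.[v ord0] * v ord_max + p2.[v ord0].
  rewrite /psi rmorphD rmorphM /= mevalXU !mpoly_of_poly_comp !rmorph_sum /=.
  rewrite !horner_coef; congr (_ * _ + _); apply: eq_bigr => i _;
    by rewrite mevalZ rmorphXn /= mevalXU.
have supp u : u \in msupp psi -> (u ord_max <= 1)%N && (u ord0 <= m)%N.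
  have XE i : 'X_ord0 ^+ i = 'X_[U_(ord0) *+ i] :> {mpoly rat[2]}.
    by rewrite mpolyXn.
  have le_m (i : nat) (p : {poly rat}) :
      (size p <= m.+1)%N -> (i < size p)%N -> (i <= m)%N.
    by move=> sp isp; rewrite -ltnS (leq_trans isp).
  rewrite /psi !mpoly_of_poly_comp mulr_suml => /msuppD_le; rewrite mem_cat.
  case/orP => /msupp_sum_le /flattenP[_ /mapP[i _ ->]].
    rewrite -scalerAl XE -mpolyXD => /msuppZ_le; rewrite msuppX inE => /eqP->.
    by rewrite !mnmDE !mulmnE !mnm1E /= mul1n addn0 (le_m _ _ s1).
  rewrite XE => /msuppZ_le; rewrite msuppX inE => /eqP->.
  by rewrite !mulmnE !mnm1E /= mul1n (le_m _ _ s2).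
(* Two consecutive values of [s] recover [p1] and [p2] as integer combinations of values of [N],
   which makes both of them integer-valued for large [r]. *)
have p1E r : (r0 <= r)%N -> p1.[r%:R] = (N r s0.+1)%:R - (N r s0)%:R.
  by move=> rr; rewrite !NE // -natr1; ring.
have p2E r : (r0 <= r)%N ->
    p2.[r%:R] = (N r s0)%:R - ((N r s0.+1)%:R - (N r s0)%:R) * s0%:R.
  by move=> rr; rewrite -p1E // NE //; ring.
exists psi; split.
- apply: (@numerical_eventually_nat _ _ (maxn r0 s0)) => v vN.
  rewrite psiE -NE ?natr_int //.
    by have := vN ord0; rewrite geq_max => /andP[].
  by have := vN ord_max; rewrite geq_max => /andP[].
- by move=> r s rr ss; rewrite psiE NE // !(tnth_nth 0).
- by apply: deg_in_leP => u /supp/andP[].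
- by apply: deg_in_leP => u /supp/andP[].
exists psi1, psi2; split=> //.
- apply: (@numerical_eventually_nat _ _ r0) => v vN.
  by rewrite mpoly_of_polyE p1E // rpredB ?natr_int.
- apply: (@numerical_eventually_nat _ _ r0) => v vN.
  by rewrite mpoly_of_polyE p2E // !(rpredB, rpredM) ?natr_int.
Qed.

(** * Algebraic dependence and transcendence bases *)

Section Dependence.
Variable A : comNzRingType.
Implicit Types (J : A -> Prop) (S : {pred A}) (a b : A) (g : {poly A}).

(** Proper ideals are taken as [Prop]-valued predicates so that the reflexive closure, defined by an
    existential statement, is covered along with [P]. *)
Record pideal J : Prop := PIdeal {
  pideal0 : J 0;
  pidealB : forall a b, J a -> J b -> J (a - b);
  pidealM : forall a b, J b -> J (a * b);
  pideal1 : ~ J 1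
}.

Lemma pidealD J a b : pideal J -> J a -> J b -> J (a + b).
Proof.
move=> idJ Ja Jb; rewrite -[b]opprK -[- b]sub0r.
by apply: (pidealB idJ) => //; apply: (pidealB idJ) => //; exact: (pideal0 idJ).
Qed.

(* Modulo a prime ideal J, this says that a is algebraic over the fraction
   field of the image of S. *)
Definition dependent J S a : Prop :=
  exists g, [/\ forall i, g`_i \in S, exists i, ~ J g`_i & J g.[a]].

Lemma dependent_sub J S S' a :
  {subset S <= S'} -> dependent J S a -> dependent J S' a.
Proof. by move=> SS' [g [gS gi ga]]; exists g; split=> // i; exact/SS'. Qed.

(** Applying [f] to the coefficients keeps one of them outside the ideal, because the preimage of
    [J'] lies in [J]. The value [g.[a]] has to vanish only after [f] is applied; this allows a
    relation modulo the reflexive closure to be moved into the ideal itself. *)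
Lemma dependent_morph (f : A -> A) J J' S S' a g :
    zmod_morphism f -> monoid_morphism f ->
    (forall b, b \in S -> f b \in S') -> (forall b, J' (f b) -> J b) ->
    (forall i, g`_i \in S) -> (exists i, ~ J g`_i) -> J' (f g.[a]) ->
  dependent J' S' (f a).
Proof.
move=> fB fM fS fJ gS [i gi] ga.
pose F : {rmorphism A -> A} := HB.pack f
  (GRing.isZmodMorphism.Build A A f fB) (GRing.isMonoidMorphism.Build A A f fM).
exists (map_poly F g); split.
- by move=> j; rewrite coef_map; exact: fS.
- by exists i; rewrite coef_map => /fJ.
- by rewrite horner_map.
Qed.

(** This is the chain rule: [e] is the value at [a] of the polynomial obtained by applying [D] to
    the coefficients of [g]. *)
Lemma derivation_horner (D : A -> A) (S S' : {pred A}) a g :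
    zmod_morphism D -> (forall b c, D (b * c) = D b * c + b * D c) ->
    subring_closed S' -> a \in S' -> (forall b, b \in S -> D b \in S') ->
    (forall i, g`_i \in S) ->
  exists2 e, e \in S' & D g.[a] = e + g^`().[a] * D a.
Proof.
move=> DB DM [S'1 S'B S'M] aS' DS.
have S'0 : 0 \in S' by rewrite -(subrr 1); exact: S'B.
have S'D b c : b \in S' -> c \in S' -> b + c \in S'.
  by move=> bS cS; rewrite -[c]opprK -[- c]sub0r S'B ?S'B.
have [D0 DD] := additiveD DB.
elim/poly_ind: g => [|p c IH] gS.
  by exists 0; rewrite // deriv0 !horner0 mul0r addr0.
have [|e eS' De] := IH.
  by move=> i; have := gS i.+1; rewrite coefD coefMX coefC addr0.
have cS : c \in S by have := gS 0%N; rewrite coefD coefMX coefC add0r.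
exists (e * a + D c); first by rewrite S'D ?S'M ?DS.
rewrite derivD derivC addr0 derivM derivX mulr1 !hornerE /= DD DM De.
ring.
Qed.

Lemma dependent_deriv (D : A -> A) J (S S' : {pred A}) a :
    pideal J -> (forall b, J b -> J (D b)) ->
    (forall k, exists u : A, u * k.+1%:R = 1) ->
    zmod_morphism D -> (forall b c, D (b * c) = D b * c + b * D c) ->
    subring_closed S -> subring_closed S' -> {subset S <= S'} ->
    (forall b, b \in S -> D b \in S') -> a \in S' ->
  dependent J S a -> dependent J S' (D a).
Proof.
move=> idJ JD char0 DB DM [S1 SB SM] S'ring SS' DS aS' [g [gS gi ga]].
have S0 : 0 \in S by rewrite -(subrr 1); exact: SB.
have SD b c : b \in S -> c \in S -> b + c \in S.
  by move=> bS cS; rewrite -[c]opprK -[- c]sub0r SB ?SB.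
have SMn b n : b \in S -> b *+ n \in S.
  by move=> bS; elim: n => // n IH; rewrite mulrS SD.
have [n] := ubnP (size g); elim: n => // n IHn in g gS gi ga *.
move=> gn; have [g'a|g'a] := boolp.EM (J g^`().[a]); last first.
  have [e eS' De] := derivation_horner DB DM S'ring aS' DS gS.
  have [S'1 S'B S'M] := S'ring.
  have S'0 : 0 \in S' by exact: SS'.
  have [D0 DD] := additiveD DB.
  have hS' : g^`().[a] \in S'.
    rewrite horner_coef; apply: (big_ind (fun b => b \in S')) => // [b c bS cS|i _].
      by rewrite -[c]opprK -[- c]sub0r S'B ?S'B.
    rewrite S'M //; first by rewrite coef_deriv SS' ?SMn.
    by elim: (val i) => [|k IHk]; rewrite ?expr0 // exprS S'M.
  exists (g^`().[a] *: 'X + e%:P); split.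
  - by move=> [|[|i]]; rewrite coefD coefZ coefX coefC /= ?mulr0 ?mulr1 ?add0r ?addr0.
  - by exists 1%N; rewrite coefD coefZ coefX coefC /= mulr1 addr0.
  - by rewrite !hornerE /= addrC -De; exact: JD.
have [g'i|g'J] := boolp.EM (exists i, ~ J g^`()`_i).
  apply: (IHn _ _ g'i g'a) => [i|]; first by rewrite coef_deriv SMn.
  case: gi => i gi; have g0 : g != 0.
    by apply/eqP => gz; apply: gi; rewrite gz coef0; exact: (pideal0 idJ).
  by rewrite -ltnS; apply: leq_trans gn; rewrite ltnS lt_size_deriv.
(* If the derivative has all its coefficients in [J], then so has [g] in positive degrees, since
   positive integers are invertible. As [g.[a]] is in [J], the constant coefficient is in [J] as
   well, a contradiction. *)
have {}g'J i : J g`_i.+1.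
  have [u uE] := char0 i.
  have : J g^`()`_i by apply: boolp.contrapT => nJ; apply: g'J; exists i.
  move/(pidealM idJ u); rewrite coef_deriv -mulr_natr mulrCA uE mulr1.
  exact.
case: gi => -[|i] gi; last by case: gi.
case: gi; have -> : g`_0 = g.[a] - \sum_(i < (size g).-1) a ^+ i.+1 * g`_i.+1.
  rewrite (horner_coef_wide a (leqSpred _)) big_ord_recl expr0 mulr1.
  by under [X in _ - X]eq_bigr do rewrite mulrC; rewrite addrK.
apply: (pidealB idJ) => //.
apply: (big_ind J) => [|b c|i _]; first exact: (pideal0 idJ).
  exact: pidealD.
exact: (pidealM idJ).
Qed.

End Dependence.

Lemma mpoly_rmorph_eq (K : comNzRingType) (S : comNzRingType) d
    (f g : {rmorphism {mpoly K[d]} -> S}) :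
  (forall c, f c%:MP = g c%:MP) -> (forall i, f 'X_i = g 'X_i) -> f =1 g.
Proof.
move=> fgC fgX p; rewrite (mpolyE p) !rmorph_sum; apply: eq_bigr => u _ /=.
rewrite -mul_mpolyC !rmorphM fgC mpolyXE_id !rmorph_prod /=; congr (_ * _).
by apply: eq_bigr => i _; rewrite !rmorphXn fgX.
Qed.

(** * Algebraic closure of a finitely generated subfield *)

Section AlgebraicClosure.
Variables (K L : fieldType) (iota : {rmorphism K -> L}) (d : nat).
Variable b : d.-tuple L.

Local Notation ev := (mmap iota (tnth b)).

Local Notation isgen z :=
  (exists p q : {mpoly K[d]}, ev q != 0 /\ z = ev p / ev q).

(** The subfield of [L] generated by the entries of [b] over the image of [K]. *)
Definition gen_field : {pred L} := fun z =>
  boolp.asbool (exists p q : {mpoly K[d]}, ev q != 0 /\ z = ev p / ev q).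

Lemma gen_fieldP z : reflect
  (exists p q : {mpoly K[d]}, ev q != 0 /\ z = ev p / ev q) (z \in gen_field).
Proof. exact: boolp.asboolP. Qed.

Lemma gen_field_mem p : ev p \in gen_field.
Proof. by apply/gen_fieldP; exists p, 1; rewrite rmorph1 oner_neq0 divr1. Qed.

Lemma gen_field_divring : divring_closed gen_field.
Proof.
split.
- by rewrite -(rmorph1 ev) gen_field_mem.
- move=> _ _ /gen_fieldP[p [q [q0 ->]]] /gen_fieldP[p' [q' [q'0 ->]]].
  apply/gen_fieldP; exists (p * q' - p' * q), (q * q').
  rewrite rmorphB !rmorphM /= mulf_neq0 //; split=> //.
  by field; apply/andP.
- move=> _ _ /gen_fieldP[p [q [q0 ->]]] /gen_fieldP[p' [q' [q'0 ->]]].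
  have [p'0|p'0] := eqVneq (ev p') 0.
    by rewrite p'0 mul0r invr0 mulr0 -(rmorph0 ev) gen_field_mem.
  apply/gen_fieldP; exists (p * q'), (q * p').
  rewrite !rmorphM /= mulf_neq0 //; split=> //.
  by field; apply/and3P.
Qed.

HB.instance Definition _ := GRing.isDivringClosed.Build L gen_field gen_field_divring.

Definition genF := {z : L | z \in gen_field}.

HB.instance Definition _ := SubChoice.on genF.
HB.instance Definition _ := [SubChoice_isSubIntegralDomain of genF by <:].
HB.instance Definition _ := [SubIntegralDomain_isSubField of genF by <:].

Lemma gen_field_exists : exists (F : fieldType) (inF : {rmorphism F -> L}),
  (forall p, exists a, inF a = ev p) /\ (forall a, isgen (inF a)).
Proof.
exists genF, (val : {rmorphism genF -> L}); split=> [p|a].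
  by exists (Sub (ev p) (gen_field_mem p)).
exact/gen_fieldP/(valP a).
Qed.

Section Algebraic.
Variables (F : fieldType) (inF : {rmorphism F -> L}).
Hypothesis inF_ev : forall p, exists a, inF a = ev p.
Hypothesis inF_gen : forall a, isgen (inF a).

Definition algebraic_in (z : L) : Prop := algebraicOver inF z.

Lemma algebraic_in_ev p : algebraic_in (ev p).
Proof.
by have [a <-] := inF_ev p; exact: algebraic_id.
Qed.

Lemma algebraic_in_root (g : {poly L}) z :
  (forall i, algebraic_in g`_i) -> g != 0 -> root g z -> algebraic_in z.
Proof.
move=> gA g0 gz; apply/integral_algebraic; apply: (integral_root g0 gz).
by move=> _ /(nthP 0)[i _ <-]; apply/integral_algebraic; exact: gA.
Qed.

Lemma clear_denominators (g : {poly F}) :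
  exists (q : {poly {mpoly K[d]}}) (c : {mpoly K[d]}),
    ev c != 0 /\ map_poly ev q = ev c *: map_poly inF g.
Proof.
elim/poly_ind: g => [|g a [q [c [c0 qE]]]].
  by exists 0, 1; rewrite rmorph1 oner_neq0 !map_poly0 scaler0.
have [p [r [r0 aE]]] := inF_gen a.
exists (r *: (q * 'X) + (c * p)%:P), (r * c); split.
  by rewrite rmorphM mulf_neq0.
rewrite !rmorphD /= map_polyZ !rmorphM /= !map_polyX !map_polyC /= qE.
rewrite aE.
rewrite scalerDr -scalerAl scalerA; congr (_ + _).
rewrite scale_polyC -polyCM; congr polyC.
by field.
Qed.

(** Clearing denominators gives a nonzero polynomial over [K[d]] that vanishes at [z] once its
    coefficients are evaluated at [b]; read in [d.+1] variables, it is a relation between [z] and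
    [b]. *)
Lemma algebraic_in_dependent z :
  algebraic_in z -> ~ alg_indep iota [tuple of z :: b].
Proof.
move=> [g g0 gz] indep.
have [q [c [c0 qE]]] := clear_denominators g.
have mqz : (map_poly ev q).[z] = 0 by rewrite qE hornerZ (rootP gz) mulr0.
have q0 : q != 0.
  apply: contraNneq g0 => q0; move: qE; rewrite q0 rmorph0 => /esym/eqP.
  by rewrite scaler_eq0 (negPf c0) /= map_poly_eq0.
(* The variable 0 stands for [z] and the others are shifted by one. The map [back] undoes this
   passage, so that [S] can be zero only if [q] is. *)
pose sh := mmap (@mpolyC d.+1 K) (fun i : 'I_d => 'X_(lift ord0 i)).
pose S := (map_poly sh q).['X_ord0].
pose back := mmap (polyC \o @mpolyC d K)
  (fun j => if unlift ord0 j is Some i then ('X_i)%:P else 'X).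
have evS : mmap iota (tnth [tuple of z :: b]) S = 0.
  rewrite /S -horner_map /= mmapX mmap1U tnth0 -mqz -map_poly_comp.
  congr horner; apply: eq_map_poly => p /=.
  apply: (mpoly_rmorph_eq (f := mmap iota (tnth [tuple of z :: b]) \o sh)
    (g := ev)) => [a|i] /=.
    by rewrite /sh !mmapC.
  by rewrite /sh !mmapX !mmap1U mmapX mmap1U tnthS.
have backS : back S = q.
  rewrite /S /back -horner_map /= mmapX mmap1U unlift_none -map_poly_comp.
  rewrite -[RHS]comp_polyXr; congr horner; apply: eq_map_poly => p /=.
  apply: (mpoly_rmorph_eq (f := back \o sh) (g := polyC)) => [a|i] /=.
    by rewrite /sh /back !mmapC.
  by rewrite /sh /back !mmapX !mmap1U mmapX mmap1U liftK.
by move/eqP: q0; apply; rewrite -backS (indep _ evS) /back rmorph0.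
Qed.

End Algebraic.

(* C is the algebraic closure in L of the field generated by b. *)
Lemma algebraic_closure_exists : exists C : L -> Prop,
  [/\ forall p, C (ev p),
      [/\ forall x y, C x -> C y -> C (x + y),
          forall x y, C x -> C y -> C (x * y) & forall x, C x -> C x^-1],
      forall (g : {poly L}) x, (forall i, C g`_i) -> g != 0 -> root g x -> C x
    & forall z, C z -> ~ alg_indep iota [tuple of z :: b]].
Proof.
have [F [inF [inF_ev inF_gen]]] := gen_field_exists.
exists (algebraic_in inF); split.
- exact: algebraic_in_ev.
- by split; [exact: algebraic_add|exact: algebraic_mul|exact: algebraic_inv].
- exact: algebraic_in_root.
- exact: algebraic_in_dependent.
Qed.

End AlgebraicClosure.

(** * Algebraic dependence between indeterminates modulo an ideal *)

Section PolyringDependence.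
Variables (K : fieldType) (I : choiceType).
Local Notation R := (polyring K I).
Implicit Types (J : R -> Prop) (V W U : {pred I}) (x y : I).

Definition dep J V x : Prop := dependent J (poly_in V : {pred R}) (prX K x).

Definition indep J V : Prop :=
  forall f : R, f \in poly_in V -> J f -> f = 0.

Lemma poly_in_map (f : R -> R) V V' :
    (forall c, f (prC I c) \in poly_in V') ->
    (forall x, x \in V -> f (prX K x) \in poly_in V') ->
    (forall p q, p \in poly_in V -> q \in poly_in V ->
       f p \in poly_in V' -> f q \in poly_in V' -> f (p + q) \in poly_in V') ->
    (forall p q, p \in poly_in V -> q \in poly_in V ->
       f p \in poly_in V' -> f q \in poly_in V' -> f (p * q) \in poly_in V') ->
  forall p, p \in poly_in V -> f p \in poly_in V'.
Proof.
move=> fC fX fD fM p pV.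
suff [] : p \in poly_in V /\ f p \in poly_in V' by [].
move: p pV; apply: poly_in_ind => [c|x xV|a b [aV a'] [bV b']|a b [aV a'] [bV b']].
- by split; rewrite ?poly_inC ?fC.
- by split; rewrite ?poly_inX ?fX.
- by split; [exact: (rpredD aV bV)|exact: fD].
- by split; [exact: (rpredM aV bV)|exact: fM].
Qed.

Lemma poly_in_sub V V' : {subset V <= V'} ->
  {subset (poly_in V : {pred R}) <= (poly_in V' : {pred R})}.
Proof.
move=> VV' p; apply: (@poly_in_map id) => [c|x /VV'|a b _ _|a b _ _].
- exact: poly_inC.
- by rewrite poly_inX.
- exact: (@rpredD R).
- exact: (@rpredM R).
Qed.

Lemma dep_sub J V V' x : {subset V <= V'} -> dep J V x -> dep J V' x.
Proof. by move=> VV'; apply: dependent_sub; exact: poly_in_sub. Qed.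

Lemma poly_in_horner V W x : (forall y, y \in W -> y \in V \/ y = x) ->
  forall f, f \in poly_in W ->
  exists2 g : {poly R}, forall i, g`_i \in poly_in V & f = g.[prX K x].
Proof.
move=> WV; have V0 : 0 \in (poly_in V : {pred R}) by exact: rpred0.
apply: poly_in_ind => [c|y /WV[yV|->]|_ _ [g gV ->] [h hV ->]|_ _ [g gV ->] [h hV ->]].
- exists (prC I c)%:P => [i|]; last by rewrite hornerC.
  by rewrite coefC; case: eqP => // _; exact: poly_inC.
- exists (prX K y)%:P => [i|]; last by rewrite hornerC.
  by rewrite coefC; case: eqP => // _; rewrite poly_inX.
- exists 'X => [i|]; last by rewrite hornerX.
  by rewrite coefX; case: eqP => // _; exact: rpred1.
- exists (g + h) => [i|]; last by rewrite hornerD.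
  by rewrite coefD; exact: (rpredD (gV i) (hV i)).
- exists (g * h) => [i|]; last by rewrite hornerM.
  by rewrite coefM; apply: (@rpred_sum R) => j _; exact: (rpredM (gV _) (hV _)).
Qed.

Lemma prC_D (a b : K) : prC I (a + b) = prC I a + prC I b.
Proof. exact: (additiveD (@prC_B K I)).2. Qed.

Lemma poly_in0 (f : R) : f \in poly_in pred0 -> exists c, f = prC I c.
Proof.
move: f; apply: poly_in_ind => [c|x //|_ _ [a ->] [b ->]|_ _ [a ->] [b ->]].
- by exists c.
- by exists (a + b); rewrite prC_D.
- by exists (a * b); rewrite prC_M.
Qed.

Lemma indep0 J : pideal J -> indep J pred0.
Proof.
move=> idJ _ /poly_in0[c ->] Jc.
have [->|c0] := eqVneq c 0; first exact: prC_0.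
case: (pideal1 idJ); have := pidealM idJ (prC I c^-1) Jc.
by rewrite -prC_M mulVf // prC_1.
Qed.

(** A relation over [W] is a polynomial in [x] over [K[V]]. Its coefficients lie in [J] because [x]
    is not dependent on [V], and hence vanish by the independence of [V]. *)
Lemma indep_add J V W x : pideal J -> indep J V -> ~ dep J V x ->
  (forall y, y \in W -> y \in V \/ y = x) -> indep J W.
Proof.
move=> idJ iV nd WV f /(poly_in_horner WV)[g gV ->] Jg.
have gJ i : g`_i = 0.
  apply: iV => //; apply: boolp.contrapT => nJ.
  by apply: nd; exists g; split=> //; exists i.
have -> : g = 0 by apply/polyP => i; rewrite coef0.
by rewrite horner0.
Qed.

Lemma indep_cat J (below : I -> {pred I}) (ys xs : seq I) : pideal J ->
    indep J (mem ys) -> (forall x, x \in xs -> {subset ys <= below x}) ->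
    pairwise (fun y x => y \in below x) xs ->
    (forall x, x \in xs -> ~ dep J (below x) x) ->
  indep J (mem (ys ++ xs)).
Proof.
move=> idJ iys; elim/last_ind: xs => [|xs x IH]; first by rewrite cats0.
rewrite pairwise_rcons => ysb /andP[/allP xsb pw] nd.
have xsS y : y \in xs -> y \in rcons xs x by rewrite mem_rcons inE orbC => ->.
have iV : indep J (mem (ys ++ xs)).
  by apply: IH => // y yxs; [apply: ysb|apply: nd]; exact: xsS.
have xin : x \in rcons xs x by rewrite mem_rcons mem_head.
apply: (indep_add idJ iV (x := x)) => [dx|y].
  apply: (nd x xin); apply: dep_sub dx => y.
  by rewrite [y \in _]mem_cat => /orP[/(ysb x xin)|/xsb].
rewrite -rcons_cat [y \in _]mem_rcons inE => /orP[/eqP->|]; first by right.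
by left.
Qed.

Lemma indep_subideal J J' V : (forall f, J f -> J' f) -> indep J' V -> indep J V.
Proof. by move=> JJ' iV f fV /JJ'; exact: iV. Qed.

Section SubstMpoly.
Import monalg.

(** Distinct indeterminates send distinct exponent vectors to distinct monomials, so each
    coefficient of [p] can be read off the image. *)
Lemma mpoly_subst_inj (d : nat) (xs : d.-tuple I) (p : mpoly.mpoly d K) :
  uniq xs ->
  mpoly.mmap (@prC K I) (fun i => prX K (tnth xs i)) p = 0 -> p = 0.
Proof.
move=> Uxs p0; apply/mpoly.mpolyP => w; rewrite mpoly.mcoeff0.
pose h (u : mpoly.multinom d) : {cmonom I} :=
  \big[mul/one]_(i < d) mon_pow (tnth xs i) (u i).
have hE u i : h u (tnth xs i) = u i.
  rewrite (big_morph (fun v : {cmonom I} => v (tnth xs i))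
    (fun v v' => cmM _ v v') (cm1 _)) (bigD1 i) //= mon_powE eqxx muln1.
  rewrite big1 ?addn0 // => j ji; rewrite mon_powE.
  by rewrite (inj_eq (tuple_uniqP _ Uxs)) (negPf ji) muln0.
have h_inj : injective h.
  by move=> u v e; apply/mpoly.mnmP => i; rewrite -hE e hE.
have mmap1E u : mpoly.mmap1 (fun i => prX K (tnth xs i)) u = prM K (h u).
  rewrite /h (big_morph (@prM K I) (@prmonM K I) (erefl : prM K one = 1 :> R)).
  by apply: eq_bigr => i _; rewrite prX_exp.
have coeffCM c u v : mcoeff v (prC I c * prM K u) = c *+ (u == v).
  exact: (etrans (f_equal (mcoeff v) (esym (prU c u))) (mcoeffU _ _ _)).
have := f_equal (mcoeff (h w)) p0; rewrite mcoeff0 => <-; apply: esym.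
apply: (etrans (raddf_sum (mcoeff (h w)) _ _ _)).
apply: (etrans (eq_bigr (fun u => mpoly.mcoeff u p *+ (u == w)) _)) => [u _|].
  rewrite mmap1E; apply: (etrans (coeffCM _ _ _)).
  by rewrite (inj_eq h_inj).
have [wp|wp] := boolP (w \in mpoly.msupp p); last first.
  rewrite (mpoly.memN_msupp_eq0 wp) big_seq big1 // => u up.
  by case: eqP up wp => [->->|]; rewrite ?mulr0n.
rewrite (bigD1_seq w) ?mpoly.msupp_uniq //= eqxx mulr1n big1 ?addr0 // => u.
by move=> /negPf->; rewrite mulr0n.
Qed.

End SubstMpoly.

End PolyringDependence.

Lemma fraction_num_den (D : idomainType) (z : {fraction D}) :
  exists a b : D, b != 0 /\ z = FracField.tofrac a / FracField.tofrac b.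
Proof.
elim/quotW: z => x; exists (frac x).1, (frac x).2; split; first exact: denom_ratioP.
have d0 : FracField.tofrac (frac x).2 != 0 by rewrite tofrac_eq0 denom_ratioP.
apply: (mulIf d0); rewrite divfK //; unlock FracField.tofrac.
rewrite -[LHS]FracField.pi_mul; apply/eqmodP => /=.
rewrite /FracField.mulf FracField.equivfE.
rewrite !numden_Ratio ?mulr1 ?mul1r ?mulf_neq0 ?oner_neq0 ?denom_ratioP //.
by rewrite mulrC.
Qed.

Lemma mmap_poly_in (K : fieldType) (I : choiceType) (U : {pred I}) d
    (xs : d.-tuple I) (p : {mpoly K[d]}) :
    (forall x, x \in (xs : seq I) -> x \in U) ->
  mmap (@prC K I) (fun i => prX K (tnth xs i)) p \in (poly_in U : {pred polyring K I}).
Proof.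
move=> xsU; apply: (@rpred_sum (polyring K I)) => u _.
apply: (@rpredM (polyring K I)); first exact: poly_inC.
apply: (@rpred_prod (polyring K I)) => i _; apply: (@rpredX (polyring K I)).
by rewrite poly_inX xsU ?mem_tnth.
Qed.

(** * Transcendence bases consisting of indeterminates *)

Section ResidueTrdeg.
Variables (K : fieldType) (I : choiceType) (U : {pred I}).
Variable P : prime_idealr (polyring K I).
Local Notation R := (polyring K I).
Local Notation L := (residue_field U P).
Local Notation J := (fun f : R => f \in (P : {pred R})).

Definition to_residue (a : subpoly K U) : L :=
  FracField.tofrac (\pi_({ideal_quot (@contraction K I U P)})%qT a).

(** Extending the residue map by 0 outside [K[U]] avoids carrying membership proofs inside terms. *)
Definition residue (p : R) : L := to_residue (insubd 0 p).

Lemma residueE p (pU : p \in poly_in U) : residue p = to_residue (Sub p pU).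
Proof. by rewrite /residue /insubd insubT. Qed.

Lemma residueD p q : p \in poly_in U -> q \in poly_in U ->
  residue (p + q) = residue p + residue q.
Proof.
move=> pU qU; have pqU := rpredD pU qU; rewrite (residueE pU) (residueE qU).
rewrite /to_residue -!rmorphD (residueE pqU); congr to_residue.
exact: val_inj.
Qed.

Lemma residueM p q : p \in poly_in U -> q \in poly_in U ->
  residue (p * q) = residue p * residue q.
Proof.
move=> pU qU; have pqU := rpredM pU qU; rewrite (residueE pU) (residueE qU).
rewrite /to_residue -!rmorphM (residueE pqU); congr to_residue.
exact: val_inj.
Qed.

Lemma residueC c : residue (prC I c) = residue_const U P c.
Proof. by rewrite (residueE (poly_inC U c)). Qed.

Lemma residue_eq0 p : p \in poly_in U -> (residue p == 0) = (p \in (P : {pred R})).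
Proof.
move=> pU; rewrite (residueE pU) /to_residue tofrac_eq0.
rewrite -[0](rmorph0 (\pi_({ideal_quot (@contraction K I U P)})%qT)).
by rewrite -Quotient.idealrBE subr0 in_contraction.
Qed.

Lemma residue_frac (z : L) : exists p q,
  [/\ p \in poly_in U, q \in poly_in U & z = residue p / residue q].
Proof.
have surj (a : {ideal_quot (@contraction K I U P)}) :
    exists2 p, p \in poly_in U & FracField.tofrac a = residue p.
  exists (val (repr a)); first exact: valP.
  by rewrite /residue valKd /to_residue reprK.
have [a [b [_ ->]]] := fraction_num_den z.
by have [[p pU ->] [q qU ->]] := (surj a, surj b); exists p, q.
Qed.

Lemma residue_sum (T : Type) (r : seq T) (F : T -> R) :
  (forall i, F i \in poly_in U) ->
  residue (\sum_(i <- r) F i) = \sum_(i <- r) residue (F i).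
Proof.
move=> FU; elim: r => [|i r IH].
  by rewrite !big_nil; apply/eqP; rewrite residue_eq0 ?rpred0 // (@rpred0 R).
by rewrite !big_cons residueD ?IH // (@rpred_sum R).
Qed.

Lemma residue1 : residue 1 = 1.
Proof. by have := residueC 1; rewrite prC_1 rmorph1. Qed.

Lemma residue_prod (T : Type) (r : seq T) (F : T -> R) :
  (forall i, F i \in poly_in U) ->
  residue (\prod_(i <- r) F i) = \prod_(i <- r) residue (F i).
Proof.
move=> FU; elim: r => [|i r IH]; first by rewrite !big_nil residue1.
by rewrite !big_cons residueM ?IH // (@rpred_prod R).
Qed.

Lemma residueX p k : p \in poly_in U -> residue (p ^+ k) = residue p ^+ k.
Proof.
move=> pU; elim: k => [|k IH]; first by rewrite !expr0 residue1.
by rewrite !exprS residueM ?IH // (@rpredX R).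
Qed.

Lemma residue_horner (g : {poly R}) p :
    (forall i, g`_i \in poly_in U) -> p \in poly_in U ->
  residue g.[p] = (\poly_(i < size g) residue g`_i).[residue p].
Proof.
move=> gU pU; rewrite horner_coef horner_poly.
rewrite residue_sum => [|i]; last by rewrite (@rpredM R) // (@rpredX R).
by apply: eq_bigr => i _; rewrite residueM ?residueX // (@rpredX R).
Qed.

Lemma residue_mmap d (xs : d.-tuple I) (p : {mpoly K[d]}) :
    (forall x, x \in (xs : seq I) -> x \in U) ->
  residue (mmap (@prC K I) (fun i => prX K (tnth xs i)) p) =
    mmap (residue_const U P) (fun i => residue (prX K (tnth xs i))) p.
Proof.
move=> xsU; have XU i : prX K (tnth xs i) \in poly_in U.
  by rewrite poly_inX xsU ?mem_tnth.
have prodU u : mmap1 (fun i => prX K (tnth xs i)) u \in (poly_in U : {pred R}).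
  by apply: (@rpred_prod R) => i _; exact: (@rpredX R).
rewrite residue_sum => [|u]; last by rewrite (@rpredM R) // poly_inC.
rewrite [RHS]/mmap; apply: eq_bigr => u _.
apply: etrans (residueM (poly_inC U p@_u) (prodU u)) _.
apply: (f_equal2 (@GRing.mul L) (residueC _)).
apply: etrans (residue_prod _ _) _ => [i|]; first exact: (@rpredX R).
by apply: eq_bigr => i _; exact: residueX.
Qed.

(** Independence modulo [P] passes to the images of [xs]. Conversely, let [C] be the algebraic
    closure of the field they generate: induction on the rank [rk] puts every indeterminate of [U]
    into [C], and then all of [L], which consists of fractions of polynomials in these. *)
Lemma has_trdeg_residue (xs : seq I) (rk : I -> nat) (below : I -> {pred I}) :
    uniq xs -> {subset xs <= U} -> indep J (mem xs) ->
    (forall x, x \in U -> {subset below x <= U}) ->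
    (forall x y, x \in U -> y \in below x -> (rk y < rk x)%N) ->
    (forall x, x \in U -> x \in xs \/ dep J (below x) x) ->
  has_trdeg (residue_const U P) (size xs).
Proof.
move=> Uxs xsU ixs belowU below_rk spanU.
pose b := [tuple of [seq residue (prX K x) | x <- in_tuple xs]].
have bE : tnth b =1 fun i => residue (prX K (tnth (in_tuple xs) i)).
  by move=> i; rewrite tnth_map.
have evE p : mmap (residue_const U P) (tnth b) p =
    residue (mmap (@prC K I) (fun i => prX K (tnth (in_tuple xs) i)) p).
  rewrite residue_mmap //; apply: eq_bigr => u _; congr (_ * _).
  exact: mmap1_eq.
exists b; split=> [p|].
  rewrite evE => /eqP; rewrite residue_eq0 ?mmap_poly_in // => pP.
  by apply: (@mpoly_subst_inj K I _ (in_tuple xs)) => //; apply: ixs => //;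
    apply: mmap_poly_in.
have [C [Cev [CD CM CV] Croot Cdep]] := algebraic_closure_exists (residue_const U P) b.
move=> z; apply: Cdep.
have CK c : C (residue_const U P c) by have := Cev c%:MP; rewrite mmapC.
have CV' (V : {pred I}) : {subset V <= U} ->
    (forall x, x \in V -> C (residue (prX K x))) ->
    forall p, p \in poly_in V -> C (residue p).
  move=> VU CX p pV; suff [] : p \in poly_in U /\ C (residue p) by [].
  move: p pV; apply: poly_in_ind => [c|x xV|p q [pU Cp] [qU Cq]|p q [pU Cp] [qU Cq]].
  - by rewrite poly_inC residueC.
  - by rewrite poly_inX; split; [exact: VU|exact: CX].
  - by rewrite residueD //; split; [exact: (@rpredD R)|exact: CD].
  - by rewrite residueM //; split; [exact: (@rpredM R)|exact: CM].
have CX x : x \in U -> C (residue (prX K x)).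
  have [k] := ubnP (rk x); elim: k x => // k IH x xk xU.
  have [xxs|[g [gS [j gj] gx]]] := spanU x xU.
    have /tnthP[i xE] : x \in in_tuple xs by [].
    by have := Cev 'X_i; rewrite mmapX mmap1U bE -xE.
  have gU i : g`_i \in (poly_in U : {pred R}) by exact: poly_in_sub (belowU x xU) _ (gS i).
  apply: (Croot (\poly_(i < size g) residue g`_i)).
  - move=> i; rewrite coef_poly; case: ifP => _; last by have := CK 0; rewrite rmorph0.
    apply: CV' (gS i); first exact: belowU.
    move=> y yx; apply: IH; last exact: belowU yx.
    by rewrite -ltnS (leq_trans _ xk) // ltnS below_rk.
  - apply/eqP => /polyP/(_ j); rewrite coef_poly coef0; case: ltnP => [_|jg].
      by move/eqP; rewrite residue_eq0.
    by case: gj; rewrite nth_default ?rpred0.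
  - apply/eqP; rewrite -residue_horner ?poly_inX //; apply/eqP.
    rewrite residue_eq0 // horner_coef (@rpred_sum R) // => i _.
    by rewrite (@rpredM R) // (@rpredX R) // poly_inX.
have [p [q [pU qU ->]]] := residue_frac z.
by apply: CM; last apply: CV; exact: (CV' U).
Qed.

End ResidueTrdeg.

(** * Leaders *)

Section PolyringMaps.
Variables (K : fieldType) (I : choiceType).
Local Notation R := (polyring K I).

Lemma pr_deriv_poly_in (d : K -> K) (f : I -> I) (V V' : {pred I}) :
    zmod_morphism d -> (forall a b, d (a * b) = d a * b + a * d b) ->
    {subset V <= V'} -> (forall x, x \in V -> f x \in V') ->
  forall p : R, p \in poly_in V -> pr_deriv d f p \in poly_in V'.
Proof.
move=> dB dM VV' fV; apply: poly_in_map => [c|x xV|p q _ _ pV qV|p q pV qV pV' qV'].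
- by rewrite pr_derivC // poly_inC.
- by rewrite pr_derivX // poly_inX fV.
- have e : pr_deriv d f (p + q) = pr_deriv d f p + pr_deriv d f q.
    exact: (additiveD (pr_deriv_additive f dB)).2.
  by rewrite e; exact: (rpredD pV qV).
- rewrite (pr_deriv_leibniz f dB dM p q).
  have [pV2 qV2] := (poly_in_sub VV' pV, poly_in_sub VV' qV).
  exact: (rpredD (rpredM pV' qV2) (rpredM pV2 qV')).
Qed.

Lemma pr_endo_poly_in (s : K -> K) (f : I -> I) (V V' : {pred I}) :
    zmod_morphism s -> monoid_morphism s -> (forall x, x \in V -> f x \in V') ->
  forall p : R, p \in poly_in V -> pr_endo s f p \in poly_in V'.
Proof.
move=> sB sM fV; apply: poly_in_map => [c|x xV|p q _ _ pV qV|p q pV qV pV' qV'].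
- by rewrite pr_endoC // poly_inC.
- by rewrite pr_endoX // poly_inX fV.
- have e : pr_endo s f (p + q) = pr_endo s f p + pr_endo s f q.
    exact: (additiveD (pr_endo_additive f sB)).2.
  by rewrite e; exact: (rpredD pV qV).
- have e : pr_endo s f (p * q) = pr_endo s f p * pr_endo s f q.
    exact: (pr_endo_multiplicative f sB sM).2.
  by rewrite e; exact: (rpredM pV' qV').
Qed.

End PolyringMaps.

Lemma prC_natVM (K : fieldType) (I : choiceType) j : [pchar K] =i pred0 ->
  prC I (j.+1%:R : K)^-1 * j.+1%:R = 1.
Proof.
move=> charK; have nat_prC k : prC I (k%:R : K) = k%:R.
  elim: k => [|k IH]; first by rewrite prC_0.
  by rewrite -[in LHS]natr1 prC_D IH prC_1 natr1.
rewrite -nat_prC -prC_M mulVf ?prC_1 //.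
by have/pcharf0P-> := charK.
Qed.

Lemma iter_rmorph (A : comNzRingType) (f : A -> A) q :
  zmod_morphism f -> monoid_morphism f ->
  zmod_morphism (iter q f) /\ monoid_morphism (iter q f).
Proof.
move=> fB [f1 fM]; elim: q => [//|q [IHB [IH1 IHM]]].
by split=> [a b|]; [rewrite /= IHB fB|split=> [|a b] /=; rewrite ?IH1 ?IHM].
Qed.

Section Leaders.
Variables (K : fieldType) (m n : nat).
Variables (delta : 'I_m -> K -> K) (sigma : K -> K).
Hypotheses (charK : [pchar K] =i pred0) (dsK : is_dsring delta sigma).
Local Notation R := (polyring K (dsvar m n)).
Local Notation D := (@dspoly_delta K m n delta).
Local Notation S := (@dspoly_sigma K m n sigma).
Implicit Types (J : R -> Prop) (x y : dsvar m n) (k r s : nat).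

Import Order.DefaultProdLexiOrder.

(* Indeterminates of sigma-order at least k come before all the others. *)
Definition key k x : bool * ('X_{1..m} * (nat * 'I_n)) :=
  ((x.1.2 < k)%N, (x.1.1, (x.1.2, x.2))).

Lemma key_inj k : injective (key k).
Proof. by move=> [[t l] j] [[t' l'] j'] [_ -> -> ->]. Qed.

Definition precedes k y x : bool := (key k y < key k x)%O.

Lemma precedesE k y x : precedes k y x =
  if (y.1.2 < k)%N == (x.1.2 < k)%N then
    (y.1.1 < x.1.1)%O || (y.1.1 == x.1.1) &&
      ((y.1.2 < x.1.2)%N || (y.1.2 == x.1.2) && (y.2 < x.2)%N)
  else (x.1.2 < k)%N.
Proof.
rewrite /precedes /key !ltxi_pair /= !leEnat ?ltEord.
case: (_ < k)%N; case: (_ < k)%N => //=; case: (ltgtP y.1.1 x.1.1) => //= _.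
all: by case: (ltngtP y.1.2 x.1.2).
Qed.

(** The threshold rises with the sigma-orders, so that heads stay heads and tails stay tails. *)
Lemma precedes_sigma k y x :
  precedes k y x -> precedes k.+1 (var_sigma y) (var_sigma x).
Proof. by rewrite !precedesE /= !ltnS. Qed.

Lemma precedes_delta k i y x :
  precedes k y x -> precedes k (var_delta i y) (var_delta i x).
Proof. by rewrite !precedesE /= eqm_add2l ltmc_add2r. Qed.

Lemma precedes_var_delta k i x : precedes k x (var_delta i x).
Proof.
rewrite precedesE eqxx /=; apply/orP; left.
by rewrite lt_neqAle lemc_addl andbT -[X in X != _]add0m eqm_add2r eq_sym mnm1_eq0.
Qed.

Lemma precedes_trans k : transitive (precedes k).
Proof. by move=> y x z; exact: lt_trans. Qed.

Definition below k r s x : {pred dsvar m n} :=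
  fun y => (y \in @vars_rs m n r s) && precedes k y x.

Lemma in_below k r s x y :
  (y \in below k r s x) = (y \in @vars_rs m n r s) && precedes k y x.
Proof. by []. Qed.

Lemma in_vars_rs r s x :
  (x \in @vars_rs m n r s) = (mdeg x.1.1 <= r)%N && (x.1.2 <= s)%N.
Proof. by []. Qed.

Definition lead J k r s x : Prop := dep J (below k r s x) x.

Lemma lead_leq J k r s r' s' x : (r <= r')%N -> (s <= s')%N ->
  lead J k r s x -> lead J k r' s' x.
Proof.
move=> rr' ss'; apply: dep_sub => y; rewrite !in_below !in_vars_rs.
by move=> /andP[/andP[yr ys] ->]; rewrite (leq_trans yr) ?(leq_trans ys).
Qed.

(** The smaller indeterminates and their derivatives all precede [var_delta i x] and have order at
    most [r.+1], so [dependent_deriv] applies. *)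
Lemma lead_delta J k r s x i : pideal J -> (forall i f, J f -> J (D i f)) ->
  x \in @vars_rs m n r s -> lead J k r s x -> lead J k r.+1 s (var_delta i x).
Proof.
move=> idJ JD xrs; case: (dsK) => dB dM _ _ _ _ _.
have E : prX K (var_delta i x) = D i (prX K x).
  exact: esym (pr_derivX (@var_delta m n i) (dB i) (dM i) x).
rewrite /lead /dep E; apply: dependent_deriv.
- exact: idJ.
- exact: JD.
- move=> j; exists (prC _ (j.+1%:R : K)^-1).
  exact: prC_natVM.
- exact: pr_deriv_additive (dB i).
- exact: pr_deriv_leibniz (dB i) (dM i).
- exact: poly_in_subring.
- exact: poly_in_subring.
- apply: poly_in_sub => y; rewrite !in_below !in_vars_rs => /andP[/andP[yr ->] yx].
  by rewrite (leqW yr) (precedes_trans yx) ?precedes_var_delta.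
- apply: pr_deriv_poly_in => // y; rewrite !in_below !in_vars_rs /=.
    move=> /andP[/andP[yr ->] yx].
    by rewrite (leqW yr) (precedes_trans yx) ?precedes_var_delta.
  move=> /andP[/andP[yr ->] yx]; rewrite precedes_delta // andbT.
  by rewrite mdegD mdeg1 add1n ltnS yr.
- rewrite poly_inX in_below precedes_var_delta andbT.
  by move: xrs; rewrite !in_vars_rs => /andP[/leqW-> ->].
Qed.

Lemma iter_sigma_morph q : zmod_morphism (iter q S) /\ monoid_morphism (iter q S).
Proof.
have [_ _ SB SM _ _ _] := dspoly_dsring n dsK.
exact: (@iter_rmorph R).
Qed.

Lemma iter_sigma_delta q i f : D i (iter q S f) = iter q S (D i f).
Proof.
have [_ _ _ _ _ _ DS] := dspoly_dsring n dsK.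
by elim: q => [|q IH]; rewrite ?iterS -?IH; [by []|exact: DS].
Qed.

Lemma iter_sigmaX q x : iter q S (prX K x) = prX K (iter q (@var_sigma m n) x).
Proof.
have [_ _ sB sM _ _ _] := dsK.
by elim: q => [//|q IH]; rewrite !iterS IH; exact: (pr_endoX (@var_sigma m n) sB sM).
Qed.

Lemma iter_var_sigma q x : iter q (@var_sigma m n) x = (x.1.1, x.1.2 + q, x.2)%N.
Proof.
elim: q => [|q /= ->]; first by rewrite addn0; case: x => [[]].
by rewrite /var_sigma /mul_sigma /= addnS.
Qed.

Lemma iter_sigma_below q k r s x f : f \in poly_in (below k r s x) ->
  iter q S f \in poly_in (below (k + q) r (s + q) (iter q (@var_sigma m n) x)).
Proof.
have [_ _ sB sM _ _ _] := dsK.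
move=> fb; elim: q => [|q IH]; first by rewrite !addn0.
rewrite !addnS !iterS; apply: (pr_endo_poly_in sB sM _ IH) => y.
by rewrite !in_below !in_vars_rs /= ltnS => /andP[-> /precedes_sigma].
Qed.

(* The union of the preimages of J under the powers of sigma; for a prime
   Delta-sigma-ideal J it is the reflexive closure. *)
Definition reflexive_closure J f : Prop := exists q, J (iter q S f).

Lemma reflexive_closure_ge J f : (forall f, J f -> J (S f)) ->
  reflexive_closure J f -> exists q0, forall q, (q0 <= q)%N -> J (iter q S f).
Proof.
move=> JS [q0 Jf]; exists q0 => q /subnK<-.
by elim: (q - q0)%N => [//|d IH]; rewrite addSn iterS; exact: JS.
Qed.

Lemma reflexive_closure_pideal J : (forall f, J f -> J (S f)) ->
  pideal J -> pideal (reflexive_closure J).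
Proof.
move=> JS idJ; split.
- by exists 0%N; exact: (pideal0 idJ).
- move=> a b /(reflexive_closure_ge JS)[q Ja] /(reflexive_closure_ge JS)[q' Jb].
  exists (maxn q q'); rewrite (iter_sigma_morph _).1.
  by apply: (pidealB idJ); [apply: Ja|apply: Jb]; rewrite ?leq_maxl ?leq_maxr.
- move=> a b [q Jb]; exists q; rewrite (iter_sigma_morph _).2.2.
  exact: (pidealM idJ).
- by move=> [q]; rewrite (iter_sigma_morph _).2.1; exact: (pideal1 idJ).
Qed.

Lemma reflexive_closure_delta J i f : (forall f, J f -> J (D i f)) ->
  reflexive_closure J f -> reflexive_closure J (D i f).
Proof. by move=> JD [q Jf]; exists q; rewrite -iter_sigma_delta; exact: JD. Qed.

Lemma reflexive_closure_sub J f : J f -> reflexive_closure J f.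
Proof. by move=> Jf; exists 0%N. Qed.

Lemma reflexive_closure_iter J q f :
  reflexive_closure J (iter q S f) -> reflexive_closure J f.
Proof. by move=> [q']; rewrite -iterD; exists (q' + q)%N. Qed.

(** A large power of [S] sends the value of the relation into [J], whereas a coefficient outside the
    reflexive closure stays outside [J] under every power. *)
Lemma lead_reflexive_closure J k r s x : (forall f, J f -> J (S f)) ->
    lead (reflexive_closure J) k r s x ->
  exists q0, forall q, (q0 <= q)%N ->
    lead J (k + q) r (s + q) (iter q (@var_sigma m n) x).
Proof.
move=> JS [g [gS gi /(reflexive_closure_ge JS)[q0 gx]]]; exists q0 => q q0q.
have [SB SM] := iter_sigma_morph q.
rewrite /lead /dep -iter_sigmaX.
apply: (dependent_morph (J := reflexive_closure J)) SB SM _ _ gS gi _ => [b|b Jb|].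
- exact: iter_sigma_below.
- by exists q.
- exact: gx.
Qed.

(** The map [S] is injective modulo the reflexive closure, so it preserves nontrivial relations. *)
Lemma lead_reflexive_sigma J k r s x : (forall f, J f -> J (S f)) ->
  lead (reflexive_closure J) k r s x ->
  lead (reflexive_closure J) k.+1 r s.+1 (var_sigma x).
Proof.
move=> JS [g [gS gi gx]].
have [SB SM] := iter_sigma_morph 1.
rewrite /lead /dep -(iter_sigmaX 1) -(addn1 k) -(addn1 s).
apply: (dependent_morph (J := reflexive_closure J)) SB SM _ _ gS gi _ => [b|b|].
- exact: iter_sigma_below.
- exact: (@reflexive_closure_iter J 1).
- have [q0 gq] := reflexive_closure_ge JS gx.
  by exists q0; rewrite -iterD addn1; apply: gq.
Qed.

(** Whatever precedes a tail indeterminate for the threshold [k'] is itself in that tail, hence in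
    the larger tail for [k], where the order is the same. *)
Lemma lead_tail J k k' r s x : (k <= k')%N -> (k' <= x.1.2)%N ->
  lead J k' r s x -> lead J k r s x.
Proof.
move=> kk' k'x; apply: dep_sub => y; rewrite !in_below => /andP[->].
have kx := leq_trans kk' k'x.
rewrite !precedesE !(ltnNge x.1.2) k'x kx /=.
by have [//|k'y] := ltnP y.1.2 k'; rewrite (ltnNge y.1.2 k) (leq_trans kk' k'y).
Qed.

End Leaders.

(** * Power products as vectors *)

Section Monomials.
Variables (m : nat).
Implicit Types (v w : seq nat) (t : 'X_{1..m}).

(* A power product of order at most r is encoded by the vector of N^(m+1) of sum
   r whose first entry is r minus the order. *)
Definition mon v : 'X_{1..m} := [multinom nth 0%N (behead v) i | i < m].

Definition vec r t : seq nat := (r - mdeg t)%N :: codom t.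

Lemma size_vec r t : size (vec r t) = m.+1.
Proof. by rewrite /= size_codom card_ord. Qed.

Lemma mdeg_mon v : size v = m.+1 -> mdeg (mon v) = sumn (behead v).
Proof.
case: v => // a v [sv]; rewrite mdegE sumnE (big_nth 0%N) sv big_mkord.
by apply: eq_bigr => i _; rewrite mnmE.
Qed.

Lemma vecK r : cancel (vec r) mon.
Proof.
move=> t; apply/mnmP => i; rewrite mnmE /= (nth_map i) ?size_enum_ord //.
by rewrite nth_ord_enum.
Qed.

Lemma sumn_vec r t : (mdeg t <= r)%N -> sumn (vec r t) = r.
Proof.
move=> tr; have := mdeg_mon (size_vec r t); rewrite vecK /= => <-.
by rewrite subnK.
Qed.

Lemma monK r v : size v = m.+1 -> sumn v = r -> vec r (mon v) = v.
Proof.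
move=> sv vr; rewrite /vec (mdeg_mon sv); case: v sv vr => // a v [sv] /= <-.
rewrite addnK; congr (_ :: _); apply: (@eq_from_nth _ 0%N).
  by rewrite size_codom card_ord.
rewrite size_codom card_ord => i im.
rewrite (nth_map (Ordinal im)) ?size_enum_ord //.
by rewrite mnmE /= nth_enum_ord.
Qed.

Lemma mon_le v w : all2 leq v w -> (mon v <= mon w)%MM.
Proof.
move=> vw; apply/mnm_lepP => i; rewrite !mnmE.
case: v w vw => [|a v] [|b w] //= /andP[_].
elim: v w (val i) => [|a' v IH] [|b' w] // k /= /andP[ab vw].
by case: k => //= k; exact: IH.
Qed.

Lemma multinom_add_ind (Q : nat -> 'X_{1..m} -> Prop) :
    (forall i r t, (mdeg t <= r)%N -> Q r t -> Q r.+1 (U_(i) + t)%MM) ->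
  forall r t d, (mdeg t <= r)%N -> Q r t -> Q (r + mdeg d)%N (d + t)%MM.
Proof.
move=> QS r t d tr Qt; have [e] := ubnP (mdeg d); elim: e => // e IH in d *.
have [->|d0] := eqVneq d 0%MM; first by rewrite mdeg0 addn0 add0m.
have [i di] : exists i, d i != 0%N.
  apply/existsP; apply: contraNT d0; rewrite negb_exists => /forallP h.
  by apply/eqP/mnmP => i; rewrite mnm0E; have := h i; rewrite negbK => /eqP.
have Ud : (U_(i) <= d)%MM by rewrite lep1mP.
have -> : d = (U_(i) + (d - U_(i)))%MM by rewrite addmC submK.
set d' := (d - U_(i))%MM; rewrite mdegD mdeg1 add1n ltnS addnS -addmA => de.
by apply: QS; [rewrite mdegD addnC leq_add|exact: IH].
Qed.

End Monomials.

Section UpClosed.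
Variables (K : fieldType) (m n : nat).
Variables (delta : 'I_m -> K -> K) (sigma : K -> K).
Hypotheses (charK : [pchar K] =i pred0) (dsK : is_dsring delta sigma).
Local Notation R := (polyring K (dsvar m n)).
Local Notation D := (@dspoly_delta K m n delta).
Variable J : R -> Prop.
Hypotheses (idJ : pideal J) (JD : forall i f, J f -> J (D i f)).

Lemma lead_multinom k r s (t d : 'X_{1..m}) l (j : 'I_n) :
    (mdeg t <= r)%N -> (l <= s)%N -> lead J k r s (t, l, j) ->
  lead J k (r + mdeg d) s ((d + t)%MM, l, j).
Proof.
move=> tr ls; apply: (multinom_add_ind (Q := fun r t => lead J k r s (t, l, j))) tr.
move=> i {d}r {}t tr; apply: (lead_delta charK dsK i idJ JD).
by rewrite in_vars_rs tr.
Qed.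

(** An increase in the later entries is a multiplication by derivations, treated in [lead_multinom];
    an increase in the first entry only enlarges the bound on the order, treated in [lead_leq]. *)
Lemma lead_upclosed k s s' v w l (j : 'I_n) :
    size v = m.+1 -> all2 leq v w -> (l <= s <= s')%N ->
    lead J k (sumn v) s (mon m v, l, j) ->
  lead J k (sumn w) s' (mon m w, l, j).
Proof.
move=> sv vw /andP[ls ss'].
have sw : size w = m.+1.
  by move: vw; rewrite all2E => /andP[/eqP<-].
have vd : (mdeg (mon m v) <= sumn v)%N.
  by rewrite mdeg_mon //; case: (v) => //= a v'; rewrite leq_addl.
have vwm := mon_le m vw.
have e : (sumn (behead w) = mdeg (mon m w - mon m v)%MM + sumn (behead v))%N.
  by rewrite -(mdeg_mon sw) -(mdeg_mon sv) -mdegD submK.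
have le : (sumn v + mdeg (mon m w - mon m v)%MM <= sumn w)%N.
  case: v w vw e sv {sw vd vwm} => [//|a v] [//|b w] /= /andP[ab _] e _; lia.
move=> /(lead_multinom (mon m w - mon m v)%MM vd ls).
rewrite (submK vwm); exact: lead_leq.
Qed.

End UpClosed.

(** * Stability of the tail leaders and of the head leaders *)

Section Tail.
Variables (K : fieldType) (m n : nat).
Variables (delta : 'I_m -> K -> K) (sigma : K -> K).
Hypotheses (charK : [pchar K] =i pred0) (dsK : is_dsring delta sigma).
Local Notation R := (polyring K (dsvar m n)).
Local Notation D := (@dspoly_delta K m n delta).
Local Notation S := (@dspoly_sigma K m n sigma).
Variable J : R -> Prop.
Hypotheses (idJ : pideal J) (JD : forall i f, J f -> J (D i f)).
Hypothesis JS : forall f, J f -> J (S f).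
Local Notation Jr := (reflexive_closure sigma J).

(** The sigma-order is [k + l] and [t] is the room left below the bound on it; in these coordinates
    the leaders of the reflexive closure are monotone in [k], [l] and [t]. *)
Definition tail_lead (I : R -> Prop) (j : 'I_n) k l t v : Prop :=
  lead I k (sumn v) (k + l + t) (mon m v, k + l, j)%N.

Let idJr : pideal Jr := reflexive_closure_pideal dsK JS idJ.

Let JrD i f : Jr f -> Jr (D i f).
Proof. by apply: (reflexive_closure_delta dsK); exact: JD. Qed.

Lemma tail_lead_sigma j k l t v : tail_lead Jr j k l t v -> tail_lead Jr j k.+1 l t v.
Proof. exact: (lead_reflexive_sigma dsK JS). Qed.

Lemma tail_lead_shift I j k d l t v :
  tail_lead I j (k + d) l t v -> tail_lead I j k (l + d) t v.
Proof.
have e : (k + d + l = k + (l + d))%N by rewrite -addnA (addnC d).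
rewrite /tail_lead e; apply: lead_tail; first exact: leq_addr.
by rewrite leq_add2l leq_addl.
Qed.

Lemma tail_lead_leq I j k l t v t' v' : pideal I -> (forall i f, I f -> I (D i f)) ->
    size v = m.+1 -> (t <= t')%N -> all2 leq v v' ->
  tail_lead I j k l t v -> tail_lead I j k l t' v'.
Proof.
move=> idI ID sv tt' vv'; apply: (lead_upclosed charK dsK idI ID sv vv').
by rewrite leq_addr leq_add2l.
Qed.

Lemma tail_lead_reflexive j k l t v :
  tail_lead Jr j k l t v -> eventually (fun q => tail_lead J j (k + q) l t v).
Proof.
move/(lead_reflexive_closure dsK JS) => [q0 h]; exists q0 => q /h.
by rewrite iter_var_sigma /tail_lead /= !(addnAC _ q).
Qed.

(* The leaders of the reflexive closure have finitely many minimal ones up to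
   shifts, and a single power of sigma moves all their relations into J. *)
Lemma tail_stable : exists k c,
  (forall j l t v, size v = m.+1 -> tail_lead Jr j k l t v -> tail_lead J j k l t v) /\
  (forall j l t v, size v = m.+1 ->
     tail_lead Jr j k l t v <-> tail_lead Jr j k (minn c l) (minn c t) v).
Proof.
apply: family_transfer.
- exact: tail_lead_sigma.
(* Applying sigma raises the threshold, and [tail_lead_shift] exchanges this for a rise of [l]. *)
- move=> j k l t v /tail_lead_sigma h; rewrite -addn1.
  by apply: tail_lead_shift; rewrite addn1.
- move=> j k l t v t' v'; exact: tail_lead_leq idJr JrD.
- move=> j k l t v t' v'; exact: tail_lead_leq idJ JD.
- exact: tail_lead_shift.
- exact: tail_lead_reflexive.
Qed.

(** The bound is [k + s], so it is at least the sigma-order of every head, whatever [s] is. *)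
Definition head_lead k (j : 'I_n) (l s : nat) v : Prop :=
  lead J k (sumn v) (k + s) (mon m v, l, j)%N.

Lemma head_lead_leq k j l s s' v v' : (l < k)%N -> size v = m.+1 ->
    (s <= s')%N -> all2 leq v v' ->
  head_lead k j l s v -> head_lead k j l s' v'.
Proof.
move=> lk sv ss' vv'; apply: (lead_upclosed charK dsK idJ JD sv vv').
by rewrite leq_add2l ss' (leq_trans (ltnW lk)) ?leq_addr.
Qed.

Lemma head_stable k : exists c, forall j (l : 'I_k) s v, size v = m.+1 ->
  (c <= s)%N -> head_lead k j l s v <-> head_lead k j l c v.
Proof.
have [|c cP] := @chain_stable ('I_n * 'I_k)%type m.+1
  (fun jl s v => head_lead k jl.1 jl.2 s v).
  by move=> [j l] s v s' v'; exact: head_lead_leq.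
by exists c => j l; exact: (cP (j, l)).
Qed.

End Tail.

(** * The non-leaders *)

Lemma count_sub_lt (T : eqType) (a b : pred T) (s : seq T) x :
  (forall y, a y -> b y) -> x \in s -> b x -> ~~ a x -> (count a s < count b s)%N.
Proof.
move=> ab; elim: s => // y s IH; rewrite inE => /predU1P[<-|xs] bx nax /=.
  by rewrite bx (negPf nax) ltnS; apply: sub_count.
have := IH xs bx nax; have := ab y; case: (a y) => [/(_ isT)->|_] /= ?.
  by rewrite ltnS.
by rewrite add0n (leq_trans _ (leq_addl _ _)).
Qed.

Lemma count_allpairs (T1 T2 T : Type) (f : T1 -> T2 -> T) (a : pred T) s t :
  count a [seq f x y | x <- s, y <- t] =
    (\sum_(x <- s) count (fun y => a (f x y)) t)%N.
Proof.
elim: s => [|x s IH]; first by rewrite big_nil.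
by rewrite big_cons -IH [LHS]count_cat count_map.
Qed.

Section Sort.
Import Order.DefaultProdLexiOrder.
Variables (m n k : nat).
Implicit Types s : seq (dsvar m n).

Definition key_sort s := sort (relpre (key k) <=%O) s.

Lemma mem_key_sort s x : (x \in key_sort s) = (x \in s).
Proof. exact: mem_sort. Qed.

Lemma pairwise_key_sort s : uniq s -> pairwise (precedes k) (key_sort s).
Proof.
move=> us; apply: (@sub_pairwise _ (relpre (key k) <%O)) => //.
rewrite -pairwise_map.
rewrite -sorted_pairwise; last exact: lt_trans.
rewrite lt_sorted_uniq_le map_inj_uniq ?sort_uniq ?us /=; last exact: key_inj.
by rewrite sorted_map; apply: sort_sorted => x y; exact: le_total.
Qed.
End Sort.

Section AllVars.
Variables (m n : nat).

Definition all_slots r s : seq (nat * seq nat) :=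
  [seq (l, v) | l <- iota 0 s.+1, v <- compositions m.+1 r].

Lemma mem_all_slots r s l v :
  ((l, v) \in all_slots r s) = (l <= s)%N && ((size v == m.+1) && (sumn v == r)).
Proof.
rewrite -mem_compositions; apply/allpairsP/andP => [[[l' v'] [ls vc [-> ->]]]|[ls vc]].
  by move: ls; rewrite mem_iota ltnS.
by exists (l, v); split=> //; rewrite mem_iota ltnS.
Qed.

Definition all_vars r s : seq (dsvar m n) :=
  [seq (mon m lv.2, lv.1, j) | j <- enum 'I_n, lv <- all_slots r s].

Lemma mem_all_vars r s x : (x \in all_vars r s) = (x \in @vars_rs m n r s).
Proof.
rewrite in_vars_rs; apply/allpairsP/andP => [[[j [l v]] [_ + ->]]|[xr xs]].
  rewrite mem_all_slots => /andP[ls /andP[/eqP sv /eqP vr]]; split=> //.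
  by rewrite mdeg_mon // -vr; case: (v) => //= a w; rewrite leq_addl.
case: x xr xs => [[t l] j] xr xs; exists (j, (l, vec r t)); rewrite mem_enum vecK.
by split=> //; rewrite mem_all_slots size_vec sumn_vec ?eqxx ?andbT.
Qed.

(** Since [mon] forgets the first entry of a vector, injectivity rests on the common sum [r]. *)
Lemma all_vars_uniq r s : uniq (all_vars r s).
Proof.
apply: allpairs_uniq; first exact: enum_uniq.
  apply: allpairs_uniq => [||[l v] [l' v'] _ _ [-> ->]] //.
    exact: iota_uniq.
  exact: compositions_uniq.
have slotP j l v : (j, (l, v)) \in [seq (x, y) | x <- enum 'I_n, y <- all_slots r s] ->
    (l, v) \in all_slots r s.
  by case/allpairsP=> -[j' lv] [_ + [_ ->]].
move=> [j [l v]] [j' [l' v']] /slotP + /slotP.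
rewrite !mem_all_slots => /andP[_ /andP[/eqP sv /eqP vr]].
move=> /andP[_ /andP[/eqP sv' /eqP vr']] e.
have e1 : mon m v = mon m v' := congr1 (fun x => x.1.1) e.
have -> : l = l' := congr1 (fun x => x.1.2) e.
have -> : j = j' := congr1 snd e.
by rewrite -(monK sv vr) e1 (monK sv' vr').
Qed.

Lemma count_all_vars (a : pred (dsvar m n)) r s :
  count a (all_vars r s) = (\sum_(j < n) \sum_(0 <= l < s.+1)
    count (fun v => a (mon m v, l, j)) (compositions m.+1 r))%N.
Proof.
rewrite count_allpairs big_enum; apply: eq_bigr => j _.
by rewrite count_allpairs /index_iota subn0.
Qed.

End AllVars.

Section Basis.
Variables (K : fieldType) (m n : nat).
Variables (delta : 'I_m -> K -> K) (sigma : K -> K).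
Hypothesis dsK : is_dsring delta sigma.
Local Notation R := (polyring K (dsvar m n)).
Variable P : prime_idealr (polyring K (dsvar m n)).
Local Notation S := (@dspoly_sigma K m n sigma).
Local Notation J := (fun f : R => f \in (P : {pred R})).
Local Notation Jr := (reflexive_closure sigma J).
Hypothesis JS : forall f, J f -> J (S f).

Lemma prime_pideal : pideal J.
Proof.
split.
- exact: rpred0.
- exact: rpredB.
- move=> a b; exact: idealMr.
- by rewrite idealr1.
Qed.

(** Heads are tested modulo [P], but tails modulo its reflexive closure, where the leaders are
    stable under shifts and can be counted. *)
Definition leader k r s x : bool :=
  boolp.asbool (if (x.1.2 < k)%N then lead J k r s x else lead Jr k r s x).

Definition nonleaders k r s : seq (dsvar m n) :=
  [seq x <- all_vars m n r s | ~~ leader k r s x].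

Lemma indep_nonleaders k r s : indep J (mem (nonleaders k r s)).
Proof.
have idJ := prime_pideal; have idJr := reflexive_closure_pideal dsK JS idJ.
pose tl : pred (dsvar m n) := fun x => (k <= x.1.2)%N.
pose ys := key_sort k (filter tl (nonleaders k r s)).
pose zs := key_sort k (filter (predC tl) (nonleaders k r s)).
have ysE x : (x \in ys) = tl x && (x \in nonleaders k r s).
  by rewrite mem_key_sort mem_filter.
have zsE x : (x \in zs) = ~~ tl x && (x \in nonleaders k r s).
  by rewrite mem_key_sort mem_filter.
have nlE x : x \in nonleaders k r s -> ~~ leader k r s x /\ x \in @vars_rs m n r s.
  by rewrite mem_filter mem_all_vars => /andP[].
have unl : uniq (nonleaders k r s) by rewrite filter_uniq ?all_vars_uniq.
have pw (a : pred (dsvar m n)) : pairwise (fun y x => y \in below k r s x)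
    (key_sort k (filter a (nonleaders k r s))).
  apply: (@sub_in_pairwise _ (@vars_rs m n r s) (precedes k)).
  - by move=> y x yrs _ yx; rewrite in_below yrs.
  - apply/allP => x; rewrite mem_key_sort mem_filter => /andP[_ /nlE[]//].
  - by apply: pairwise_key_sort; exact: filter_uniq.
(* The tail non-leaders are independent modulo the reflexive closure, hence modulo the smaller ideal
   [J]. Every head comes after all of them, so the heads can be appended by arguing modulo [J]. *)
have iys : indep J (mem ys).
  apply: (indep_subideal (J' := Jr)) => [f Jf|]; first exact: reflexive_closure_sub.
  apply: (@indep_cat _ _ Jr (below k r s) [::] ys idJr) => //; last first.
  - move=> x; rewrite ysE => /andP[kx /nlE[+ _]].
    by rewrite /leader ltnNge -/(tl x) kx => /boolp.asboolPn.
  - exact: pw.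
  - move=> f f0; apply: (indep0 idJr); apply: poly_in_sub f0 => y.
    by rewrite [y \in _]in_nil.
have izs : indep J (mem (ys ++ zs)).
  apply: (indep_cat (below := below k r s) idJ iys).
  - move=> x; rewrite zsE => /andP[xk _] y; rewrite ysE => /andP[ky /nlE[_ yrs]].
    rewrite in_below yrs precedesE (ltnNge y.1.2 k) (ltnNge x.1.2 k).
    by rewrite -/(tl y) -/(tl x) ky (negPf xk).
  - exact: pw.
  - move=> x; rewrite zsE => /andP[kx /nlE[+ _]].
    by rewrite /leader ltnNge -/(tl x) kx => /boolp.asboolPn.
move=> f fnl; apply: izs; apply: poly_in_sub fnl => x xnl.
by rewrite [x \in _]mem_cat ysE zsE xnl !andbT orbN.
Qed.

Variable k : nat.
Hypothesis tail_leadP : forall j l t v, size v = m.+1 ->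
  tail_lead Jr j k l t v -> tail_lead J j k l t v.

Lemma leader_lead r s x : x \in @vars_rs m n r s -> leader k r s x -> lead J k r s x.
Proof.
rewrite in_vars_rs /leader => /andP[xr xs] /boolp.asboolP.
case: ltnP => // kx.
have e I : lead I k r s x = tail_lead I x.2 k (x.1.2 - k) (s - x.1.2) (vec r x.1.1).
  rewrite /tail_lead (sumn_vec xr) vecK (subnKC kx) (subnKC xs).
  by case: x {xr xs kx} => [[]].
by rewrite !e; apply: tail_leadP; exact: size_vec.
Qed.

Lemma has_trdeg_nonleaders r s :
  has_trdeg (Lrs_const P r s) (size (nonleaders k r s)).
Proof.
(* The rank of an indeterminate is the number of its predecessors in T(r,s)Y. *)
apply: (has_trdeg_residue (rk := fun x => count (precedes k ^~ x) (all_vars m n r s))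
  (below := below k r s)).
- by rewrite filter_uniq ?all_vars_uniq.
- by move=> x; rewrite mem_filter mem_all_vars => /andP[].
- exact: indep_nonleaders.
- by move=> x _ y; rewrite in_below => /andP[].
- move=> x y xrs; rewrite in_below => /andP[yrs yx].
  apply: (@count_sub_lt _ _ _ _ y) => //.
  + by move=> z zy; exact: precedes_trans yx.
  + by rewrite mem_all_vars.
  + by rewrite /precedes ltxx.
- move=> x xrs; have [lx|nlx] := boolP (leader k r s x).
    by right; exact: leader_lead lx.
  by left; rewrite mem_filter nlx mem_all_vars.
Qed.

End Basis.

(** For [s] at least [2c], the first [c] terms have second index at least [c], the last [c] terms
    have first index at least [c], and the [s.+1 - c.*2] terms between them have both. *)
Lemma sum_antidiagonal (T : nat -> nat -> nat) c s : (c.*2 <= s)%N ->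
    (forall i t, T i t = T (minn c i) (minn c t)) ->
  (\sum_(0 <= i < s.+1) T i (s - i) =
     \sum_(i < c) T i c + \sum_(t < c) T c t + (s.+1 - c.*2) * T c c)%N.
Proof.
move=> cs TE; rewrite -addnn in cs *.
rewrite (big_cat_nat (n := c)) //=; last by lia.
rewrite (big_cat_nat (n := (s.+1 - c)%N) (m := c)) /=; [|by lia|by lia].
have -> : (\sum_(0 <= i < c) T i (s - i) = \sum_(i < c) T i c)%N.
  rewrite big_mkord; apply: eq_bigr => i _; have := ltn_ord i => ic.
  by rewrite TE [RHS]TE; congr (T _ _); lia.
have -> : (\sum_(c <= i < s.+1 - c) T i (s - i) = (s.+1 - (c + c)) * T c c)%N.
  rewrite subnDA -sum_nat_const_nat; apply: eq_big_nat => i /andP[ci ic].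
  by rewrite TE [RHS]TE; congr (T _ _); lia.
have -> : (\sum_(s.+1 - c <= i < s.+1) T i (s - i) = \sum_(t < c) T c t)%N.
  rewrite -{1}[(s.+1 - c)%N]add0n big_addn subKn; last by lia.
  rewrite big_nat_rev big_mkord; apply: eq_bigr => i _; have := ltn_ord i => ic.
  by rewrite TE [RHS]TE; congr (T _ _); lia.
by rewrite addnA addnAC.
Qed.

(** * Counting the non-leaders by a polynomial *)

Section Main.
Variables (K : fieldType) (m n : nat).
Variables (delta : 'I_m -> K -> K) (sigma : K -> K).
Hypotheses (charK : [pchar K] =i pred0) (dsK : is_dsring delta sigma).
Local Notation R := (polyring K (dsvar m n)).
Variable P : prime_idealr (polyring K (dsvar m n)).
Local Notation D := (@dspoly_delta K m n delta).
Local Notation S := (@dspoly_sigma K m n sigma).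
Local Notation J := (fun f : R => f \in (P : {pred R})).
Local Notation Jr := (reflexive_closure sigma J).
Hypothesis JD : forall i f, J f -> J (D i f).
Hypothesis JS : forall f, J f -> J (S f).

Lemma size_nonleaders k r s : size (nonleaders sigma P k r (k + s)) =
  (\sum_(j < n) (\sum_(l < k) hilb m.+1 (head_lead J k j l s) r +
     \sum_(0 <= i < s.+1) hilb m.+1 (tail_lead Jr j k i (s - i)) r))%N.
Proof.
rewrite size_filter count_all_vars; apply: eq_bigr => j _.
rewrite -addnS (big_cat_nat (n := k)) ?leq_addr //; congr (_ + _)%N.
  rewrite big_mkord; apply: eq_bigr => l _; apply: eq_in_count => v.
  rewrite mem_compositions => /andP[_ /eqP vr].
  by rewrite /leader /= ltn_ord /head_lead vr.
rewrite -{1}[k]add0n big_addn addKn; apply: eq_big_nat => i /andP[_ si].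
apply: eq_in_count => v; rewrite mem_compositions => /andP[_ /eqP vr].
by rewrite /leader /= ltnNge leq_addl /= /tail_lead vr (addnC i) -addnA subnKC.
Qed.

Lemma trdeg_polynomials : exists (p1 p2 : {poly rat}) (N : nat -> nat -> nat) r0 s0,
  [/\ (size p1 <= m.+1)%N, (size p2 <= m.+1)%N,
      forall r s, has_trdeg (Lrs_const P r s) (N r s)
    & forall r s, (r0 <= r)%N -> (s0 <= s)%N ->
        (N r s)%:R = p1.[r%:R] * s%:R + p2.[r%:R] :> rat].
Proof.
have idJ := prime_pideal P; have idJr := reflexive_closure_pideal dsK JS idJ.
have JrD i f : Jr f -> Jr (D i f).
  by apply: (reflexive_closure_delta dsK) => g; exact: JD.
have [k [c [tailP tailE]]] := tail_stable charK dsK idJ JD JS.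
have [c' headE] := head_stable charK dsK idJ JD k.
have tail_up j i t : upclosed m.+1 (tail_lead Jr j k i t).
  by move=> v w sv vw; apply: (tail_lead_leq charK dsK idJr JrD sv (leqnn t) vw).
have head_up j (l : 'I_k) t : upclosed m.+1 (head_lead J k j l t).
  move=> v w sv vw.
  by apply: (head_lead_leq charK dsK idJ JD (ltn_ord l) sv (leqnn t) vw).
pose tr j i t r := hilb m.+1 (tail_lead Jr j k i t) r.
pose hd j (l : nat) r := hilb m.+1 (head_lead J k j l c') r.
have trE j r i t : tr j i t r = tr j (minn c i) (minn c t) r.
  by apply: eq_hilb => v sv _; exact: tailE.
(* [A] collects the heads and both ends of the antidiagonal, and [B] is the value repeated in its
   middle; neither depends on [s]. *)
pose A r := (\sum_(j < n) (\sum_(l < k) hd j l r +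
  (\sum_(i < c) tr j i c r + \sum_(t < c) tr j c t r)))%N.
pose B r := (\sum_(j < n) tr j c c r)%N.
have sizeE r s : (maxn c' c.*2 <= s)%N ->
    size (nonleaders sigma P k r (k + s)) = (A r + (s.+1 - c.*2) * B r)%N.
  rewrite geq_max => /andP[c's cs]; rewrite size_nonleaders.
  rewrite /A /B big_distrr -big_split; apply: eq_bigr => j _ /=.
  rewrite -addnA; congr (_ + _)%N.
    by apply: eq_bigr => l _; apply: eq_hilb => v sv _; exact: headE.
  by apply: (sum_antidiagonal (T := fun i t => tr j i t r)) cs _ => i t; exact: trE.
have evtr j i t : evpoly m.+1 (fun r => (tr j i t r)%:R) by exact: hilb_evpoly.
have evhd j (l : 'I_k) : evpoly m.+1 (fun r => (hd j l r)%:R) by exact: hilb_evpoly.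
clearbody tr hd.
have [pA sA [a AE]] : evpoly m.+1 (fun r => (A r)%:R).
  apply: (@eq_evpoly _ (fun r => \sum_(j < n) (\sum_(l < k) (hd j l r)%:R +
    (\sum_(i < c) (tr j i c r)%:R + \sum_(t < c) (tr j c t r)%:R)))).
    exists 0%N => r _; rewrite [RHS]natr_sum; apply: eq_bigr => j _.
    by rewrite [RHS]natrD [in RHS]natrD 3!natr_sum.
  apply: evpoly_sum => j; apply: evpolyD; last by apply: evpolyD; exact: evpoly_sum.
  exact: evpoly_sum.
have [pB sB [b BE]] : evpoly m.+1 (fun r => (B r)%:R).
  apply: (@eq_evpoly _ (fun r => \sum_(j < n) (tr j c c r)%:R)).
    by exists 0%N => r _; rewrite [RHS]natr_sum.
  exact: evpoly_sum.
(* With [s = k + s'], the multiplicity [s'.+1 - c.*2] of [B] equals [s + (1 - (k + c.*2))], whence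
   the slope [pB] and the constant term. *)
exists pB, (pA + (1 - (k + c.*2)%:R) *: pB),
  (fun r s => size (nonleaders sigma P k r s)), (maxn a b), (k + maxn c' c.*2)%N.
split=> //.
- rewrite (leq_trans (size_polyD _ _)) // geq_max sA.
  exact: leq_trans (size_scale_leq _ _) sB.
- by move=> r s; exact: (has_trdeg_nonleaders dsK JS tailP).
move=> r s; rewrite geq_max => /andP[ar br] ks.
have [s' s'E] : exists s', s = (k + s')%N.
  by exists (s - k)%N; rewrite subnKC // (leq_trans _ ks) ?leq_addr.
rewrite s'E leq_add2l in ks *; rewrite sizeE // natrD natrM AE // BE //.
rewrite hornerD hornerZ natrB; last first.
  by move: ks; rewrite geq_max => /andP[_]; exact: leqW.
by rewrite !natrD -natr1; ring.
Qed.

End Main.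

Theorem theorem4p2 (K : fieldType) (m n : nat)
    (delta : 'I_m -> K -> K) (sigma : K -> K)
    (P : prime_idealr (dspoly K m n)) :
  [pchar K] =i pred0 ->
  is_dsring delta sigma ->
  is_dsideal (dspoly_delta delta) (dspoly_sigma sigma) P ->
  exists psi : {mpoly rat[2]},
    [/\ numerical psi,
        exists r0 s0 : nat, forall r s : nat, (r0 <= r)%N -> (s0 <= s)%N ->
          exists2 d : nat, has_trdeg (Lrs_const P r s) d
                         & psi.@[tnth [tuple r%:R; s%:R]] = d%:R,
        (deg_in ord_max psi <= 1)%N,
        (deg_in ord0 psi <= m)%N
      & exists psi1 psi2 : {mpoly rat[1]},
          [/\ numerical psi1, numerical psi2
            & psi = (psi1 \mPo [tuple 'X_ord0]) * 'X_ord_max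
                    + (psi2 \mPo [tuple 'X_ord0])]].
Proof.
move=> charK dsK [PD PS].
have [p1 [p2 [N [r0 [s0 [s1 s2 Ntr NE]]]]]] := trdeg_polynomials charK dsK PD PS.
have [psi [psi_num psiE deg_s deg_r lin]] := bivariate_of_polys s1 s2 NE.
exists psi; split=> //; exists r0, s0 => r s rr ss.
by exists (N r s); [exact: Ntr|exact: psiE].
Qed.
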